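(* Let $H$ be a Hopf algebra over a field $\Bbbk$, $A$ a right $H$-comodule algebra with coaction $\Delta_A(a)=a_0\otimes a_1$, and $\mathfrak{g}\subseteq(H^\circ)^+$ a quantum tangent space with basis $\{\chi_i\}$ and $f_i^j\in H^\circ$ such that $\Delta(\chi_i)=\chi_i\otimes\varepsilon+\sum_jf_i^j\otimes\chi_j$. Set $\mathfrak{X}:=A\otimes\mathfrak{g}$ and $\mathscr{L}\colon\mathfrak{X}\to\mathrm{End}_\Bbbk(A)$, $\mathscr{L}_{a\otimes\chi}(a'):=aa'_0\chi(a'_1)$. (1) $\mathfrak{X}$ admits the $A$-bimodule structure $a\cdot(a'\otimes\chi_i)\cdot a'':=\sum_jaa'a''_0f_i^j(a''_1)\otimes\chi_j$, and the Leibniz rule $\mathscr{L}_X(aa')=\mathscr{L}_X(a)a'+\mathscr{L}_{X\cdot a}(a')$ holds for all $a,a'\in A$ and $X\in\mathfrak{X}$. (2) If, in addition, $B:=A^{\mathrm{co}H}\subseteq A$ is a Hopf--Galois extension, then $(\mathfrak{X},\mathscr{L})$ is a first order vector field calculus on $A$. (3) If, yet in addition, $\mathfrak{g}$ is a bicovariant quantum tangent space, then $(\mathfrak{X},\mathscr{L})$ is a right $H$-covariant first order vector field calculus with respect to the right $H$-coaction $\Delta_{\mathfrak{X}}\colon\mathfrak{X}\to\mathfrak{X}\otimes H$, $a\otimes\chi_i\mapsto\sum_ja_0\otimes\chi_j\otimes a_1N_i^j$, where $N_i^j\in H$ are determined by $\mathrm{ad}_{\mathfrak{g}}(\chi_i)=\sum_j\chi_j\otimes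 N_i^j$.
   Context: $H^\circ$ is the finite dual Hopf algebra of $H$, $\Delta(u)(h\otimes g)=u(hg)$, unit $\varepsilon$; $(H^\circ)^+=\{u\mid u(1)=0\}$. A quantum tangent space is a finite-dimensional subspace $\mathfrak{g}\subset(H^\circ)^+$ with $\Delta(\mathfrak{g})\subset\mathfrak{g}\otimes\varepsilon+H^\circ\otimes\mathfrak{g}$. It is bicovariant if $\mathrm{ad}_{\mathfrak{g}}\colon\mathfrak{g}\to\mathrm{End}_\Bbbk(H)$, $\mathrm{ad}_{\mathfrak{g}}(\chi)(h):=h_1S(h_3)\chi(h_2)$, satisfies $\mathrm{ad}_{\mathfrak{g}}(\mathfrak{g})\subseteq\mathfrak{g}\otimes H$, where $\mathfrak{g}\otimes H\subseteq\mathrm{End}_\Bbbk(H)$ via $(\chi\otimes k)(h)=\chi(h)k$. $A$ is a right $H$-comodule algebra if $\Delta_A$ is a right coaction and an algebra map; $A^{\mathrm{co}H}=\{a\mid\Delta_A(a)=a\otimes1\}$. $B=A^{\mathrm{co}H}\subseteq A$ is Hopf--Galois if $A\otimes_BA\to A\otimes H$, $a\otimes_Ba'\mapsto aa'_0\otimes a'_1$, is bijective. A first order vector field calculus (FOVC) on $A$ is a pair $(\mathfrak{X},\mathscr{L})$: $\mathfrak{X}$ an $A$-bimodule, $\mathscr{L}\colon\mathfrak{X}\to\mathrm{End}_\Bbbk(A)$ $\Bbbk$-linear, injective, left $A$-linear ($\mathscr{L}_{a\cdot X}(b)=a\mathscr{L}_X(b)$), with $\mathscr{L}_X(ab)=\mathscr{L}_X(a)b+\mathscr{L}_{X\cdot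 a}(b)$. It is right $H$-covariant with respect to a right $H$-coaction $\Delta_{\mathfrak{X}}$ on $\mathfrak{X}$ if $\Delta_{\mathfrak{X}}(a\cdot X\cdot a')=\Delta_A(a)\Delta_{\mathfrak{X}}(X)\Delta_A(a')$ and $\mathfrak{X}\otimes A\to A$, $X\otimes a\mapsto\mathscr{L}_X(a)$, is right $H$-colinear for the diagonal coaction on $\mathfrak{X}\otimes A$. *)

(* Defs.v *)
From HB Require Import structures.
From mathcomp Require Import all_boot all_order all_algebra.
From mathcomp Require Import boolp functions.

Set Implicit Arguments.
Unset Strict Implicit.
Unset Printing Implicit Defensive.

Import GRing.Theory.
Local Open Scope ring_scope.
Local Open Scope quotient_scope.

Reserved Notation "x \ox y" (at level 40, left associativity).

(* [btensor ra la] is the abelian group generated by symbols [(m, n)], additive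
   in each entry, with [(ra m s, n) = (m, la s n)].  Formal sums are sequences;
   no formal inverses are needed because [(- m, n)] is opposite to [(m, n)]. *)

Section BalancedTensor.
Variables (S : Type) (M N : zmodType) (ra : M -> S -> M) (la : S -> N -> N).

Inductive bteq : seq (M * N) -> seq (M * N) -> Prop :=
| bteq_refl s : bteq s s
| bteq_sym s t : bteq s t -> bteq t s
| bteq_trans s t u : bteq s t -> bteq t u -> bteq s u
| bteq_cat s s' t t' : bteq s s' -> bteq t t' -> bteq (s ++ t) (s' ++ t')
| bteq_comm s t : bteq (s ++ t) (t ++ s)
| bteq_zero n : bteq [:: (0, n)] [::]
| bteq_addl m m' n : bteq [:: (m + m', n)] [:: (m, n); (m', n)]
| bteq_addr m n n' : bteq [:: (m, n + n')] [:: (m, n); (m, n')]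
| bteq_bal m s n : bteq [:: (ra m s, n)] [:: (m, la s n)].

Definition bteqb : rel (seq (M * N)) := fun s t => `[< bteq s t >].

Lemma bteqb_equiv : equiv_class_of bteqb.
Proof.
split=> [s|s t|t s u].
- exact/asboolP/bteq_refl.
- by apply/asboolP/asboolP; apply: bteq_sym.
- by move=> /asboolP st /asboolP tu; apply/asboolP; apply: bteq_trans tu.
Qed.

Canonical bteq_equivrel := EquivRelPack bteqb_equiv.

Definition btensor := {eq_quot bteqb}.
HB.instance Definition _ := Quotient.on btensor.
HB.instance Definition _ := Choice.on btensor.

Definition bten (m : M) (n : N) : btensor := \pi_btensor [:: (m, n)].

(* The map on the tensor product induced by [f].  It is defined for every [f]
   through a choice of representatives, and is meaningful when [f] is balanced:
   see [tliftE] and [tliftD]. *)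
Definition tlift (G : nmodType) (f : M -> N -> G) (t : btensor) : G :=
  \sum_(p <- repr t) f p.1 p.2.

Record balanced (G : nmodType) (f : M -> N -> G) : Prop := Balanced {
  balancedDl : forall m m' n, f (m + m') n = f m n + f m' n;
  balancedDr : forall m n n', f m (n + n') = f m n + f m n';
  balanced0l : forall n, f 0 n = 0;
  balancedS : forall m s n, f (ra m s) n = f m (la s n) }.

Lemma bteq_pi s t : bteq s t <-> \pi_btensor s = \pi_btensor t.
Proof.
split=> [st|/eqmodP/asboolP //]; exact/eqmodP/asboolP.
Qed.

Lemma tlift_pi (G : nmodType) (f : M -> N -> G) s : balanced f ->
  tlift f (\pi s) = \sum_(p <- s) f p.1 p.2.
Proof.
move=> bf; have : bteq (repr (\pi_btensor s)) s.
  by apply/bteq_pi; rewrite reprK.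
rewrite /tlift; move: (repr _) => r; elim=> {r s} //=.
- by move=> s t u _ -> _ ->.
- by move=> s s' t t' _ e _ e'; rewrite !big_cat /= e e'.
- by move=> s t; rewrite !big_cat /= addrC.
- by move=> n; rewrite big_seq1 big_nil (balanced0l bf).
- by move=> m m' n; rewrite big_seq1 !big_cons big_nil addr0 (balancedDl bf).
- by move=> m n n'; rewrite big_seq1 !big_cons big_nil addr0 (balancedDr bf).
- by move=> m s n; rewrite !big_seq1 (balancedS bf).
Qed.

Definition bt_add (t u : btensor) : btensor := \pi_btensor (repr t ++ repr u).
Definition bt_opp (t : btensor) : btensor :=
  \pi_btensor [seq (- p.1, p.2) | p <- repr t].

Lemma bt_add_pi s t :
  bt_add (\pi s) (\pi t) = \pi_btensor (s ++ t).
Proof. by apply/bteq_pi/bteq_cat; apply/bteq_pi; rewrite reprK. Qed.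

Lemma bt_addC : commutative bt_add.
Proof. by move=> t u; apply/bteq_pi/bteq_comm. Qed.

Lemma bt_addA : associative bt_add.
Proof.
by elim/quotW=> s; elim/quotW=> t; elim/quotW=> u; rewrite !bt_add_pi catA.
Qed.

Lemma bt_add0 : left_id (\pi_btensor [::]) bt_add.
Proof. by elim/quotW=> s; rewrite bt_add_pi. Qed.

Lemma bt_addN : left_inverse (\pi_btensor [::]) bt_opp bt_add.
Proof.
elim/quotW=> s; rewrite /bt_opp -[X in bt_add _ X](reprK (\pi_btensor s)).
rewrite bt_add_pi; apply/bteq_pi; elim: (repr _) => [|[m n] r IH] /=.
  exact: bteq_refl.
set q := map _ r in IH *.
have /bteq_trans : bteq ([:: (- m, n)] ++ q ++ [:: (m, n)] ++ r)
                        (([:: (- m, n)] ++ [:: (m, n)]) ++ (q ++ r)).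
  rewrite -catA; apply: bteq_cat; first exact: bteq_refl.
  rewrite !catA; apply: bteq_cat; last exact: bteq_refl.
  exact: bteq_comm.
apply; rewrite -[[::] in X in bteq _ X]/([::] ++ [::]).
apply: bteq_cat IH; apply: bteq_trans (bteq_zero n).
by apply: bteq_sym; rewrite -(addNr m); apply: bteq_addl.
Qed.

HB.instance Definition _ :=
  GRing.isZmodule.Build btensor bt_addA bt_addC bt_add0 bt_addN.

Lemma tliftE (G : nmodType) (f : M -> N -> G) m n : balanced f ->
  tlift f (bten m n) = f m n.
Proof. by move=> bf; rewrite tlift_pi // big_seq1. Qed.

Lemma tliftD (G : nmodType) (f : M -> N -> G) t u : balanced f ->
  tlift f (t + u) = tlift f t + tlift f u.
Proof.
move=> bf; elim/quotW: t => s; elim/quotW: u => r.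
by rewrite [X in tlift f X]bt_add_pi !tlift_pi // big_cat.
Qed.

Lemma tlift0 (G : nmodType) (f : M -> N -> G) : balanced f -> tlift f 0 = 0.
Proof. by move=> bf; rewrite tlift_pi // big_nil. Qed.

Lemma btensorP (t : btensor) :
  exists s : seq (M * N), t = \sum_(p <- s) bten p.1 p.2.
Proof.
elim/quotW: t => s; exists s; elim: s => [|[m n] s IH]; first by rewrite big_nil.
by rewrite big_cons -IH -[_ + _]/(bt_add _ _) bt_add_pi.
Qed.

Lemma btensor_ind (P : btensor -> Prop) :
  P 0 -> (forall m n t, P t -> P (bten m n + t)) -> forall t, P t.
Proof.
move=> P0 PD t; have [s ->] := btensorP t.
by elim: s => [|p s IH]; rewrite ?big_nil // big_cons; apply: PD.
Qed.

Lemma bten_balanced : balanced bten.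
Proof.
split=> [m m' n|m n n'|n|m s n]; rewrite -?[_ + _ in RHS]/(bt_add _ _) ?bt_add_pi.
- exact/bteq_pi/bteq_addl.
- exact/bteq_pi/bteq_addr.
- exact/bteq_pi/bteq_zero.
- exact/bteq_pi/bteq_bal.
Qed.

End BalancedTensor.

Section Tensor.
Variables (k : fieldType) (M N : lmodType k).

Definition tensor :=
  btensor (fun (m : M) (c : k) => c *: m) (fun (c : k) (n : N) => c *: n).
HB.instance Definition _ := GRing.Zmodule.on tensor.

Definition ten (m : M) (n : N) : tensor := bten _ _ m n.

Definition tbalanced (G : nmodType) (f : M -> N -> G) :=
  balanced (fun (m : M) (c : k) => c *: m) (fun (c : k) (n : N) => c *: n) f.

Definition tscale (c : k) (t : tensor) : tensor :=
  tlift (fun m n => ten (c *: m) n) t.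

Lemma ten_balanced : tbalanced ten.
Proof. exact: bten_balanced. Qed.

Lemma tscale_balanced c : tbalanced (fun m n => ten (c *: m) n).
Proof.
split=> [m m' n|m n n'|n|m s n].
- by rewrite scalerDr (balancedDl ten_balanced).
- by rewrite (balancedDr ten_balanced).
- by rewrite scaler0 (balanced0l ten_balanced).
- by rewrite scalerA mulrC -scalerA (balancedS ten_balanced).
Qed.

Lemma tscaleDr c : {morph tscale c : t u / t + u}.
Proof. by move=> t u; apply: tliftD (tscale_balanced c). Qed.

Lemma tscale_ten c m n : tscale c (ten m n) = ten (c *: m) n.
Proof. exact: tliftE (tscale_balanced c). Qed.

Lemma tscale0r c : tscale c 0 = 0.
Proof. exact: tlift0 (tscale_balanced c). Qed.

Lemma tensor_ind (P : tensor -> Prop) :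
  P 0 -> (forall m n t, P t -> P (ten m n + t)) -> forall t, P t.
Proof. exact: btensor_ind. Qed.

Lemma tscaleA a b t : tscale a (tscale b t) = tscale (a * b) t.
Proof.
elim/tensor_ind: t => [|m n t IH]; first by rewrite !tscale0r.
by rewrite !tscaleDr !tscale_ten scalerA IH.
Qed.

Lemma tscale1 : left_id 1 tscale.
Proof.
elim/tensor_ind=> [|m n t IH]; first by rewrite !tscale0r.
by rewrite !tscaleDr !tscale_ten scale1r IH.
Qed.

Lemma tscaleDl t : {morph tscale^~ t : a b / a + b}.
Proof.
move=> a b; elim/tensor_ind: t => [|m n t IH]; first by rewrite !tscale0r addr0.
rewrite !tscaleDr !tscale_ten scalerDl (balancedDl ten_balanced) IH.
by rewrite addrACA.
Qed.

HB.instance Definition _ :=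
  GRing.Zmodule_isLmodule.Build k tensor tscaleA tscale1 tscaleDr tscaleDl.

Lemma tenDl m m' n : ten (m + m') n = ten m n + ten m' n.
Proof. exact: balancedDl ten_balanced _ _ _. Qed.

Lemma tenDr m n n' : ten m (n + n') = ten m n + ten m n'.
Proof. exact: balancedDr ten_balanced _ _ _. Qed.

Lemma ten0l n : ten 0 n = 0.
Proof. exact: balanced0l ten_balanced _. Qed.

Lemma tenZl c m n : ten (c *: m) n = c *: ten m n.
Proof. by rewrite -tscale_ten. Qed.

Lemma tenZr c m n : ten m (c *: n) = c *: ten m n.
Proof. by rewrite -tenZl; symmetry; apply: balancedS ten_balanced _ _ _. Qed.

Lemma ten0r m : ten m 0 = 0.
Proof. by rewrite -(scale0r 0) tenZr scale0r. Qed.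

End Tensor.

Notation "x \ox y" := (ten x y) : ring_scope.

Section TensorMaps.
Variable k : fieldType.

Definition tmap (M M' N N' : lmodType k) (f : M -> M') (g : N -> N')
    (t : tensor M N) : tensor M' N' :=
  tlift (fun m n => f m \ox g n) t.

Definition tassoc (M N P : lmodType k) (t : tensor (tensor M N) P) :
    tensor M (tensor N P) :=
  tlift (fun x p => tlift (fun m n => m \ox (n \ox p)) x) t.

End TensorMaps.

Definition tmul (k : fieldType) (A B : algType k) (t u : tensor A B) :
    tensor A B :=
  tlift (fun a b => tlift (fun a' b' => (a * a') \ox (b * b')) u) t.

HB.mixin Record Algebra_isHopf (k : fieldType) H of GRing.Algebra k H := {
  comul : {linear H -> tensor H H};
  counit : {linear H -> k^o};
  antipode : {linear H -> H};
  comulA : forall h : H,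
    tassoc (tmap comul id (comul h)) = tmap id comul (comul h);
  counitl : forall h : H,
    tlift (fun x y : H => (counit x : k) *: y) (comul h) = h;
  counitr : forall h : H,
    tlift (fun x y : H => (counit y : k) *: x) (comul h) = h;
  comul1 : comul (1 : H) = 1 \ox 1;
  comulM : forall x y : H, comul (x * y) = tmul (comul x) (comul y);
  counit1 : counit (1 : H) = 1;
  counitM : forall x y : H, counit (x * y) = counit x * counit y;
  antipodel : forall h : H,
    tlift (fun x y : H => antipode x * y) (comul h) = (counit h : k) *: 1;
  antipoder : forall h : H,
    tlift (fun x y : H => x * antipode y) (comul h) = (counit h : k) *: 1 }.

#[short(type="hopfAlgType")]
HB.structure Definition HopfAlgebra (k : fieldType) :=
  { H of GRing.Algebra k H & Algebra_isHopf k H }.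

Section Coactions.
Variables (k : fieldType) (H : hopfAlgType k).

Record right_coaction (M : lmodType k) (rho : M -> tensor M H) : Prop := {
  coact_linear : linear rho;
  coactA : forall m, tassoc (tmap rho id (rho m)) = tmap id comul (rho m);
  coact1 : forall m,
    tlift (fun (x : M) (h : H) => (counit h : k) *: x) (rho m) = m }.

Record comodule_algebra (A : algType k) (rho : A -> tensor A H) : Prop := {
  comodule_algebra_coaction : right_coaction rho;
  comodule_algebra1 : rho 1 = 1 \ox 1;
  comodule_algebraM : forall a b, rho (a * b) = tmul (rho a) (rho b) }.

Definition colinear (M N : lmodType k) (rhoM : M -> tensor M H)
    (rhoN : N -> tensor N H) (phi : M -> N) : Prop :=
  forall m, rhoN (phi m) = tmap phi id (rhoM m).

Definition diag_coaction (M N : lmodType k) (rhoM : M -> tensor M H)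
    (rhoN : N -> tensor N H) (t : tensor M N) : tensor (tensor M N) H :=
  tlift (fun m n =>
    tlift (fun m0 m1 =>
      tlift (fun n0 n1 => (m0 \ox n0) \ox (m1 * n1)) (rhoN n)) (rhoM m)) t.

Definition coinvariants (A : algType k) (rho : A -> tensor A H) : Type :=
  {a : A | rho a = a \ox 1}.

Definition btensor_coinv (A : algType k) (rho : A -> tensor A H) :=
  btensor (fun (a : A) (b : coinvariants rho) => a * sval b)
          (fun (b : coinvariants rho) (a : A) => sval b * a).

Definition galois_map (A : algType k) (rho : A -> tensor A H)
    (t : btensor_coinv rho) : tensor A H :=
  tlift (fun a a' => tlift (fun a0 a1 => (a * a0) \ox a1) (rho a')) t.

Definition hopf_galois (A : algType k) (rho : A -> tensor A H) : Prop :=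
  bijective (@galois_map A rho).

End Coactions.

Section Subspace.
Variables (k : fieldType) (V : lmodType k) (S : submodClosed V).

Inductive subspace : predArgType := Subspace v & v \in S.
Definition sub_incl (x : subspace) : V := let: Subspace v _ := x in v.

HB.instance Definition _ := [isSub of subspace for sub_incl].
HB.instance Definition _ := [Choice of subspace by <:].

Lemma subspace_closed : submod_closed (fun v => v \in S).
Proof.
by split=> [|c u v]; rewrite -!topredE /=; [exact: rpred0|move=> Su Sv; rewrite rpredD ?rpredZ].
Qed.
HB.instance Definition _ :=
  GRing.SubChoice_isSubLmodule.Build k V _ subspace subspace_closed.

Lemma sub_incl_is_linear : linear sub_incl.
Proof. by []. Qed.
HB.instance Definition _ := GRing.isSemilinear.Build k subspace V _ sub_incl
  (GRing.semilinear_linear sub_incl_is_linear).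

End Subspace.

Definition is_basis (k : fieldType) (V : lmodType k) (n : nat)
    (e : 'I_n -> V) : Prop :=
  (forall v, exists c : 'I_n -> k, v = \sum_i c i *: e i) /\
  (forall c : 'I_n -> k, \sum_i c i *: e i = 0 -> forall i, c i = 0).

Definition finite_dimensional (k : fieldType) (V : lmodType k) : Prop :=
  exists n, exists e : 'I_n -> V, is_basis e.

Section FiniteDual.
Variables (k : fieldType) (H : hopfAlgType k).

Record two_sided_ideal (I : H -> Prop) : Prop := {
  ideal0 : I 0;
  idealD : forall x y, I x -> I y -> I (x + y);
  idealMl : forall h x, I x -> I (h * x);
  idealMr : forall h x, I x -> I (x * h) }.

(* [H / I] embeds in a finite-dimensional space. *)
Definition finite_codim (I : H -> Prop) : Prop :=
  exists n, exists p : {linear H -> 'rV[k]_n}, forall h, I h <-> p h = 0.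

Definition in_finite_dual (u : H -> k^o) : Prop :=
  linear u /\ exists I : H -> Prop,
    [/\ two_sided_ideal I, finite_codim I & forall h, I h -> u h = 0].

Definition fd_pred : {pred H -> k^o} := fun u => `[< in_finite_dual u >].

Lemma fd_predP u : reflect (in_finite_dual u) (u \in fd_pred).
Proof. exact: asboolP. Qed.

Lemma finite_codim_setI I J :
  finite_codim I -> finite_codim J -> finite_codim (fun h => I h /\ J h).
Proof.
move=> [n [p Ip]] [m [q Jq]].
have lpq : linear (fun h => row_mx (p h) (q h)).
  by move=> c x y; rewrite !linearP scale_row_mx add_row_mx.
pose L := GRing.isLinear.Build _ _ _ _ _ lpq.
pose r : {linear H -> 'rV[k]_(n + m)} := HB.pack (fun h => row_mx (p h) (q h)) L.
exists (n + m)%N, r => h; rewrite Ip Jq /=; split=> [[-> ->]|].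
  by rewrite row_mx0.
by rewrite -[0 in X in X -> _]row_mx0 => /eq_row_mx.
Qed.

Lemma fd_pred_submod : submod_closed fd_pred.
Proof.
split=> [|c u v].
  apply/fd_predP; split=> [a x y|]; first by rewrite scaler0 addr0.
  exists (fun _ => True); split=> //; exists 0, (\0 : {linear H -> 'rV[k]_0}) => h.
  by split=> // _; apply: thinmx0.
move=> /fd_predP[lu [I [iI fI uI]]] /fd_predP[lv [J [iJ fJ vJ]]].
apply/fd_predP; split=> [a x y|].
  rewrite !fctE /= lu lv !scalerDr !scalerA -!addrA; congr (_ + _); first by rewrite mulrC.
  by rewrite addrCA.
exists (fun h => I h /\ J h); split; first 1 last.
- exact: finite_codim_setI.
- by move=> h [/uI + /vJ]; rewrite !fctE /= => -> ->; rewrite scaler0 addr0.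
split.
- by split; [apply: ideal0 iI | apply: ideal0 iJ].
- by move=> x y [Ix Jx] [Iy Jy]; split; [apply: idealD iI _ _ _ _|apply: idealD iJ _ _ _ _].
- by move=> h x [Ix Jx]; split; [apply: idealMl iI _ _ _|apply: idealMl iJ _ _ _].
- by move=> h x [Ix Jx]; split; [apply: idealMr iI _ _ _|apply: idealMr iJ _ _ _].
Qed.

HB.instance Definition _ :=
  GRing.isSubmodClosed.Build k (H -> k^o) fd_pred fd_pred_submod.

Definition fdual := subspace fd_pred.
HB.instance Definition _ := GRing.Lmodule.on fdual.

Definition ev (u : fdual) (h : H) : k := sub_incl u h.

Lemma ev_linear (u : fdual) : linear (ev u : H -> k^o).
Proof. by case: u => u /= uP; have /fd_predP[] := uP. Qed.

Lemma evP c (u v : fdual) h : ev (c *: u + v) h = c * ev u h + ev v h.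
Proof. by []. Qed.

Lemma evN (u : fdual) h : ev (- u) h = - ev u h.
Proof. by []. Qed.

Lemma fdualP (u v : fdual) : (forall h, ev u h = ev v h) -> u = v.
Proof. by move=> uv; apply/val_inj/funext. Qed.

Lemma counit_fd : (counit : H -> k^o) \in fd_pred.
Proof.
apply/fd_predP; split; first exact: linearP.
have lp : linear (fun h : H => const_mx (counit h) : 'rV[k]_1).
  by move=> c x y; apply/rowP=> i; rewrite !mxE linearP.
pose L := GRing.isLinear.Build _ _ _ _ _ lp.
pose p : {linear H -> 'rV[k]_1} :=
  HB.pack (fun h : H => const_mx (counit h) : 'rV[k]_1) L.
exists (fun h => counit h = 0); split=> //; last first.
  exists 1%N, p => h; split=> [/= h0|ph0].
    by apply/rowP=> i; rewrite !mxE.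
  by have := congr1 (fun A : 'rV_1 => A 0 0) ph0; rewrite !mxE.
split=> [|x y /= ex ey|h x /= ex|h x /= ex].
- exact: linear0.
- by rewrite linearD ex ey addr0.
- by rewrite counitM ex mulr0.
- by rewrite counitM ex mul0r.
Qed.

Definition fd_unit : fdual := Subspace counit_fd.

(* The pairing of [H° ⊗ H°] with [H ⊗ H]; it is faithful by [fd_pair_inj]. *)
Definition fd_pair (t : tensor fdual fdual) (h g : H) : k :=
  tlift (fun u v => ev u h * ev v g) t.

Lemma fd_pair_balanced h g :
  tbalanced (fun u v : fdual => ev u h * ev v g).
Proof.
split=> [u u' v|u v v'|v|u c v]; rewrite /ev /= ?mulrDl ?mulrDr //.
  by rewrite mul0r.
by rewrite /= -[LHS]mulrA mulrCA.
Qed.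

Lemma fd_pair_ten u v h g : fd_pair (u \ox v) h g = ev u h * ev v g.
Proof. exact: tliftE (fd_pair_balanced h g). Qed.

Lemma fd_pairD t t' h g : fd_pair (t + t') h g = fd_pair t h g + fd_pair t' h g.
Proof. exact: tliftD (fd_pair_balanced h g). Qed.

Lemma fd_pair0 h g : fd_pair 0 h g = 0.
Proof. exact: tlift0 (fd_pair_balanced h g). Qed.

Lemma fd_pair_sum I (r : seq I) (F : I -> tensor fdual fdual) h g :
  fd_pair (\sum_(i <- r) F i) h g = \sum_(i <- r) fd_pair (F i) h g.
Proof.
by elim: r => [|i r IH]; rewrite ?big_nil ?fd_pair0 // !big_cons fd_pairD IH.
Qed.

Lemma ten_sumr I (r : seq I) (u : fdual) (F : I -> fdual) :
  u \ox (\sum_(i <- r) F i) = \sum_(i <- r) u \ox F i.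
Proof.
by elim: r => [|i r IH]; rewrite ?big_nil ?ten0r // !big_cons tenDr IH.
Qed.

Lemma ev_sum I (r : seq I) (F : I -> fdual) h :
  ev (\sum_(i <- r) F i) h = \sum_(i <- r) ev (F i) h.
Proof. by elim: r => [|i r IH]; rewrite ?big_nil // !big_cons -IH. Qed.

Lemma fd_pair_inj0 t : (forall h g, fd_pair t h g = 0) -> t = 0.
Proof.
have [s -> {t}] := btensorP t; rewrite -/(ten _ _).
have [n] := ubnP (size s); elim: n s => // n IH [|[u v] s] /= sn t0.
  by rewrite big_nil.
rewrite big_cons /=; have [u0|] := pselect (forall h, ev u h = 0).
  have -> : u = 0 by apply: fdualP => h; rewrite u0.
  rewrite -/(ten _ _) ten0l add0r; apply: IH => // h g.
  by have := t0 h g; rewrite big_cons fd_pairD fd_pair_ten /= u0 mul0r add0r.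
move=> /existsNP[h0 /eqP u0].
pose a (p : fdual * fdual) : k := ev p.1 h0 / ev u h0.
have v_eq : v = - \sum_(p <- s) a p *: p.2.
  apply: fdualP => g; rewrite evN ev_sum.
  have := t0 h0 g; rewrite big_cons fd_pairD fd_pair_ten fd_pair_sum /=.
  move=> /(canRL (addrK _)); rewrite add0r => /(canRL (mulKf u0)) ->.
  rewrite mulrN mulr_sumr; congr (- _); apply: eq_bigr => p _.
  by rewrite fd_pair_ten [RHS]/(a p * _) /a mulrA [_^-1 * _]mulrC.
have red : ten u v + \sum_(p <- s) ten p.1 p.2 =
    \sum_(p <- [seq (p.1 - a p *: u, p.2) | p <- s]) ten p.1 p.2.
  rewrite big_map /= v_eq -[X in ten u X]scaleN1r tenZr ten_sumr scaleN1r addrC.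
  rewrite -sumrB; apply: eq_bigr => p _.
  by rewrite tenDl -scaleNr tenZl tenZr scaleNr.
rewrite red; apply: IH; first by rewrite size_map.
by move=> h g; rewrite -[X in fd_pair X]red; have := t0 h g; rewrite big_cons.
Qed.

Lemma fd_pair_inj t t' :
  (forall h g, fd_pair t h g = fd_pair t' h g) -> t = t'.
Proof.
move=> tt'; apply/subr0_eq/fd_pair_inj0 => h g.
have := fd_pairD (t - t') t' h g; rewrite subrK tt' => e.
by apply: (@addIr _ (fd_pair t' h g)); rewrite add0r -e.
Qed.

Lemma finite_rank_span n (p : {linear H -> 'rV[k]_n}) :
  exists m, exists e : 'I_m -> H,
    forall h, (p h <= \matrix_(i < m) p (e i))%MS.
Proof.
pose P (r : nat) := `[< exists m, exists e : 'I_m -> H,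
  \rank (\matrix_(i < m) p (e i)) = r >].
have exP : exists r, P r.
  by exists (\rank (\matrix_(i < 0) p 0)); apply/asboolP; exists 0, (fun=> 0).
have ubP r : P r -> (r <= n)%N.
  by move=> /asboolP[m [e <-]]; apply: rank_leq_col.
case: (ex_maxnP exP ubP) => r /asboolP[m [e er]] rmax.
exists m, e => h; apply: contraT => hN.
pose e' (i : 'I_(1 + m)) := if fintype.split i is inr j then e j else h.
have e'E : \matrix_(i < 1 + m) p (e' i) =
    col_mx (p h) (\matrix_(i < m) p (e i)).
  apply/row_matrixP => i; rewrite rowK -[i]splitK /e' unsplitK.
  case: (fintype.split i) => j /=.
    by rewrite rowKu; apply/rowP=> l; rewrite mxE ord1.
  by rewrite rowKd rowK.
have /rmax : P (\rank (\matrix_(i < 1 + m) p (e' i))).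
  by apply/asboolP; exists (1 + m)%N, e'.
rewrite leqNgt => /negP[]; rewrite -er e'E -addsmxE.
apply: rank_ltmx; rewrite /ltmx addsmxSr /=.
by apply: contra hN => /(submx_trans (addsmxSl _ _)).
Qed.

Lemma fd_comul_subproof (u : fdual) :
  exists t, forall h g, fd_pair t h g = ev u (h * g).
Proof.
case: u => u uP; have /fd_predP[lu [I [iI [n [p Ip]] uI]]] := uP.
have [m [e eP]] := finite_rank_span p.
set M := \matrix_(i < m) p (e i) in eP.
pose c (i : 'I_m) : H -> k^o := fun h => (p h *m pinvmx M) 0 i.
have cP i : c i \in fd_pred.
  apply/fd_predP; split=> [a x y|].
    by rewrite /c linearP mulmxDl -scalemxAl !mxE.
  exists I; split=> //; first by exists n, p.
  by move=> h /Ip ph; rewrite /c ph mul0mx mxE.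
pose d (i : 'I_m) : H -> k^o := fun g => u (e i * g).
have dP i : d i \in fd_pred.
  apply/fd_predP; split=> [a x y|].
    by rewrite /d mulrDr -scalerAr lu.
  exists I; split=> //; first by exists n, p.
  by move=> h Ih; apply: uI; apply: (idealMl iI).
exists (\sum_(i < m) (Subspace (cP i) : fdual) \ox (Subspace (dP i) : fdual)).
move=> h g; rewrite fd_pair_sum.
under eq_bigr do rewrite fd_pair_ten /ev /=.
pose lin := GRing.isLinear.Build _ _ _ _ _ lu.
pose U : {linear H -> k^o} := HB.pack u lin.
have Ih : I (h - \sum_i (c i h : k) *: e i).
  apply/Ip; rewrite linearB linear_sum -{1}(mulmxKpV (eP h)) mulmx_sum_row.
  apply/eqP; rewrite subr_eq0; apply/eqP/eq_bigr => i _.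
  by rewrite linearZ rowK.
have := uI _ (idealMr iI g Ih).
rewrite -[u _]/(U _) mulrBl linearB => /subr0_eq; rewrite /= => ->.
rewrite -[u _]/(U _) mulr_suml linear_sum; apply: eq_bigr => i _.
by rewrite -scalerAl linearZ.
Qed.

Definition fd_comul (u : fdual) : tensor fdual fdual :=
  projT1 (cid (fd_comul_subproof u)).

Lemma fd_comulE u h g : fd_pair (fd_comul u) h g = ev u (h * g).
Proof. by rewrite /fd_comul; case: cid. Qed.

End FiniteDual.

Section TangentSpaces.
Variables (k : fieldType) (H : hopfAlgType k).

Record quantum_tangent_space (g : submodClosed (fdual H)) : Prop := {
  qts_finite : finite_dimensional (subspace g);
  qts_plus : forall u : fdual H, u \in g -> ev u 1 = 0;
  qts_comul : forall x : subspace g,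
    exists (y : subspace g) (t : tensor (fdual H) (subspace g)),
      fd_comul (sub_incl x) = sub_incl y \ox fd_unit H + tmap id (@sub_incl _ _ g) t }.

(* [h |-> h_1 S(h_3) u(h_2)] *)
Definition ad (u : fdual H) (h : H) : H :=
  tlift (fun (x : tensor H H) (h3 : H) =>
    tlift (fun h1 h2 : H => ev u h2 *: (h1 * antipode h3)) x)
    (tmap comul id (comul h)).

Definition tensor_end (g : submodClosed (fdual H))
    (t : tensor (subspace g) H) (h : H) : H :=
  tlift (fun (x : subspace g) (l : H) => ev (sub_incl x) h *: l) t.

Definition bicovariant (g : submodClosed (fdual H)) : Prop :=
  quantum_tangent_space g /\
  forall x : subspace g, exists t : tensor (subspace g) H,
    ad (sub_incl x) =1 tensor_end t.

(* [L_(a ⊗ x) a' = a a'_0 x(a'_1)] *)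
Definition tangent_action (A : algType k) (rho : A -> tensor A H)
    (g : submodClosed (fdual H)) (X : tensor A (subspace g)) (a' : A) : A :=
  tlift (fun (a : A) (x : subspace g) =>
    a * tlift (fun (a0 : A) (a1 : H) => ev (sub_incl x) a1 *: a0) (rho a')) X.

End TangentSpaces.

Section VectorFields.
Variables (k : fieldType) (A : algType k) (X : lmodType k).

Record bimodule := Bimodule {
  lact : A -> X -> X;
  ract : X -> A -> X;
  lact_linearl : forall x, linear (lact^~ x);
  lact_linearr : forall a, linear (lact a);
  ract_linearl : forall a, linear (ract^~ a);
  ract_linearr : forall x, linear (ract x);
  lact1 : forall x, lact 1 x = x;
  lactA : forall a b x, lact (a * b) x = lact a (lact b x);
  ract1 : forall x, ract x 1 = x;
  ractA : forall x a b, ract x (a * b) = ract (ract x a) b;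
  lract : forall a x b, lact a (ract x b) = ract (lact a x) b }.

Record fovc (bm : bimodule) (L : X -> A -> A) : Prop := {
  fovc_linear : forall b, linear (L^~ b);
  fovc_end : forall x, linear (L x);
  fovc_inj : injective L;
  fovc_lact : forall a x b, L (lact bm a x) b = a * L x b;
  fovc_leibniz : forall x a b, L x (a * b) = L x a * b + L (ract bm x a) b }.

Variable H : hopfAlgType k.

Definition tensor_lact (bm : bimodule) (t : tensor A H) (y : tensor X H) :
    tensor X H :=
  tlift (fun a h => tlift (fun x l => lact bm a x \ox (h * l)) y) t.

Definition tensor_ract (bm : bimodule) (y : tensor X H) (t : tensor A H) :
    tensor X H :=
  tlift (fun x l => tlift (fun a h => ract bm x a \ox (l * h)) t) y.

Record covariant_fovc (bm : bimodule) (L : X -> A -> A)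
    (rho : A -> tensor A H) (rhoX : X -> tensor X H) : Prop := {
  cov_fovc : fovc bm L;
  cov_coaction : right_coaction rhoX;
  cov_bimodule : forall a x b, rhoX (lact bm a (ract bm x b)) =
    tensor_lact bm (rho a) (tensor_ract bm (rhoX x) (rho b));
  cov_colinear :
    colinear (diag_coaction rhoX rho) rho (fun t : tensor X A => tlift L t) }.

End VectorFields.

(* Main.v *)
Require Import Defs.
From HB Require Import structures.
From mathcomp Require Import all_boot all_order all_algebra.
From mathcomp Require Import boolp.

(**
Let [v ◁ h] be the functional [x |-> v(hx) - v(h) ε(x)].  The condition
[Δ(g) ⊂ g ⊗ ε + H° ⊗ g] says that [v ◁ h] lies in [g] for every [v] in [g], and
then [◁] is a right action of [H] on [g], unital because [v(1) = 0]; in the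
basis, [χ_i ◁ h = Σ_j f_i^j(h) χ_j].  The right multiplication of
[X = A ⊗ g] is then [(a ⊗ v) b = a b_0 ⊗ (v ◁ b_1)], the action axioms give the
bimodule axioms, and the Leibniz rule is the definition of [◁] evaluated at the
coaction of a second element ([tangent_leibniz]).

The substantial point is that the Hopf-Galois condition makes [L] injective,
although the antipode [S] need not be bijective.  Let [L_X = 0] with [X = Σ a_i ⊗ v_i].  Applying
[a ⊗ h |-> a_0 ⊗ a_1 S(h)] to a preimage of [1 ⊗ h] under the Galois map shows
that [1 ⊗ S(h)] has the form [Σ b_0 c ⊗ b_1], and the elements [r] for which
[1 ⊗ r] has this form are a subalgebra [R] of [H].  Hence [Σ v_i(r) a_i = 0]
for [r] in [R].  To reach all of [H] one needs [H = R + I] for every ideal [I]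
of finite codimension ([antipode_approx]).  Write [Δ(h) = Σ p_i ⊗ q_i] and let
[S^(m)] be the convolution powers of [S].  Modulo [I] the tuples
[(S^(m)(q_i))_i] live in a finite-dimensional space, so
[Σ_m λ_m S^(m)(q_i) ∈ I] for all [i] and some nonzero [λ]; if [n] is the least
index with [λ_n <> 0], convolution on the left with the power [n + 1] of the
identity, which inverts [S], gives [λ_n h + Σ_(m > n) λ_m S^(m-n-1)(h) ∈ I],
where the sum lies in [R].  The functionals [v_i] have a common ideal of finite
codimension in their kernels, so [Σ v_i(h) a_i = 0] for every [h], and [X = 0].

For covariance let [δ(χ_i) = Σ_j χ_j ⊗ N_i^j] and write [δ(v) = v_0 ⊗ v_1].  The
defining property [Σ v_0(h) v_1 = h_1 S(h_3) v(h_2)] implies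
[v_0(h_1) v_1 h_2 = v(h_2) h_1] ([sw_delta_mul]), where the antipode has
cancelled.  Conversely an element [t] of [g ⊗ V], for a right [H]-module [V], is
determined by the values [Σ v(h_1) w h_2] with [t = Σ v ⊗ w]
([twisted_pair_inj]).  This pair of facts reduces the coassociativity of [δ]
([delta_coaction]) and the compatibility of [δ] with [◁] ([delta_act]) to
computations in which [S] no longer occurs.  The coaction of [X] is the diagonal
one ([diag_right_coaction]), built from those of [A] and [g]; its compatibility
with the bimodule structure is [delta_act], and colinearity of [L] is
[sw_delta_mul].
*)

Set Implicit Arguments.
Unset Strict Implicit.
Unset Printing Implicit Defensive.

Import GRing.Theory.
Local Open Scope ring_scope.

(** * Linear maps and sums over tensors *)

Section Linear.
Variable k : fieldType.
Implicit Types V W U X Y : lmodType k.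

Definition bilin V W U (f : V -> W -> U) : Prop :=
  (forall w, linear (fun v => f v w)) /\ (forall v, linear (f v)).

Definition trilin V W U X (f : V -> W -> U -> X) : Prop :=
  [/\ forall w u, linear (fun v => f v w u),
      forall v u, linear (fun w => f v w u)
    & forall v w, linear (f v w)].

Lemma linD V W (F : V -> W) : linear F -> {morph F : x y / x + y}.
Proof. by move=> lF x y; have := lF 1 x y; rewrite !scale1r. Qed.

Lemma lin0 V W (F : V -> W) : linear F -> F 0 = 0.
Proof.
by move=> lF; apply: (@addrI _ (F 0)); rewrite -(linD lF 0 0) [RHS]addr0 (addr0 (0 : V)).
Qed.

Lemma linZ V W (F : V -> W) : linear F -> forall c v, F (c *: v) = c *: F v.
Proof. by move=> lF c v; have := lF c v 0; rewrite (lin0 lF) !addr0. Qed.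

Lemma linB V W (F : V -> W) : linear F -> {morph F : x y / x - y}.
Proof. by move=> lF x y; rewrite -!scaleN1r (linD lF) (linZ lF). Qed.

Lemma lin_bigsum V W (F : V -> W) I (r : seq I) (P : pred I) (g : I -> V) :
  linear F -> F (\sum_(i <- r | P i) g i) = \sum_(i <- r | P i) F (g i).
Proof. by move=> lF; apply: big_morph; [apply: linD | apply: lin0]. Qed.

Lemma lin_id V : linear (fun v : V => v).
Proof. by []. Qed.

Lemma lin_comp V W U (G : W -> U) (F : V -> W) :
  linear G -> linear F -> linear (fun v => G (F v)).
Proof. by move=> lG lF c x y; rewrite lF lG. Qed.

Lemma linMl V (A : algType k) (a : A) (F : V -> A) :
  linear F -> linear (fun v => a * F v).
Proof. by move=> lF c x y; rewrite lF mulrDr scalerAr. Qed.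

Lemma linMr V (A : algType k) (a : A) (F : V -> A) :
  linear F -> linear (fun v => F v * a).
Proof. by move=> lF c x y; rewrite lF mulrDl scalerAl. Qed.

Lemma lin_scaler V W a (F : V -> W) : linear F -> linear (fun v => a *: F v).
Proof. by move=> lF c x y; rewrite lF scalerDr !scalerA mulrC. Qed.

Lemma lin_scalel V W (F : V -> k^o) (w : W) :
  linear F -> linear (fun v => (F v : k) *: w).
Proof. by move=> lF c x y; rewrite lF scalerDl scalerA. Qed.

Lemma lin_add V W (F G : V -> W) :
  linear F -> linear G -> linear (fun v => F v + G v).
Proof. by move=> lF lG c x y; rewrite lF lG scalerDr addrACA. Qed.

Lemma lin_sub V W (F G : V -> W) :
  linear F -> linear G -> linear (fun v => F v - G v).
Proof. by move=> lF lG c x y; rewrite lF lG scalerBr opprD addrACA. Qed.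

Lemma lin_sum V W I (r : seq I) (F : I -> V -> W) :
  (forall i, linear (F i)) -> linear (fun v => \sum_(i <- r) F i v).
Proof.
move=> lF c x y; rewrite scaler_sumr -big_split.
by apply: eq_bigr => i _; apply: lF.
Qed.

Lemma lin_tenl V W U (F : V -> W) (u : U) :
  linear F -> linear (fun v => F v \ox u).
Proof. by move=> lF c x y; rewrite lF tenDl tenZl. Qed.

Lemma lin_tenr V W U (F : V -> W) (u : U) :
  linear F -> linear (fun v => u \ox F v).
Proof. by move=> lF c x y; rewrite lF tenDr tenZr. Qed.

Lemma bilin_balanced V W U (f : V -> W -> U) : bilin f -> tbalanced f.
Proof.
move=> [fl fr]; split=> [m m' n|m n n'|n|m c n].
- exact: (linD (fl n)).
- exact: (linD (fr m)).
- exact: (lin0 (fl n)).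
- by rewrite (linZ (fl n)) (linZ (fr m)).
Qed.

(** A copy of [tlift] whose arguments are vector spaces.  Unification then finds
    the module structures, where [tlift] leaves only abelian groups to find;
    [sw t f] is the sum that Sweedler notation writes as [f(t_1, t_2)]. *)
Definition sw V W U (t : tensor V W) (f : V -> W -> U) : U := tlift f t.

End Linear.

Notation "\sw_ ( a , b <- t ) E" := (sw t (fun a b => E))
  (at level 41, a name, b name, t at level 200, E at level 41, right associativity,
   format "'[' \sw_ ( a ,  b  <-  t ) '/  '  E ']'") : ring_scope.

Section Sw.
Variable k : fieldType.
Implicit Types V W U X Y : lmodType k.

Lemma eq_sw V W U (f f' : V -> W -> U) t :
  (forall m n, f m n = f' m n) -> sw t f = sw t f'.
Proof. by move=> ff'; apply: eq_bigr. Qed.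

Lemma swD V W U (f f' : V -> W -> U) t :
  \sw_(m, n <- t) (f m n + f' m n) = sw t f + sw t f'.
Proof. exact: big_split. Qed.

Lemma swB V W U (f f' : V -> W -> U) t :
  \sw_(m, n <- t) (f m n - f' m n) = sw t f - sw t f'.
Proof. exact: sumrB. Qed.

Lemma sw_sum V W U I (r : seq I) (f : I -> V -> W -> U) t :
  \sw_(m, n <- t) (\sum_(i <- r) f i m n) = \sum_(i <- r) sw t (f i).
Proof. exact: exchange_big. Qed.

Lemma exchange_sw V W V' W' U (f : V -> W -> V' -> W' -> U) t u :
  \sw_(m, n <- t) \sw_(m', n' <- u) f m n m' n' =
  \sw_(m', n' <- u) \sw_(m, n <- t) f m n m' n'.
Proof. exact: exchange_big. Qed.

Lemma lin_sw V W U X (F : U -> X) (f : V -> W -> U) t :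
  linear F -> F (sw t f) = \sw_(m, n <- t) F (f m n).
Proof. exact: lin_bigsum. Qed.

Lemma swMl V W (A : algType k) (a : A) (f : V -> W -> A) t :
  a * sw t f = \sw_(m, n <- t) (a * f m n).
Proof. exact: mulr_sumr. Qed.

Lemma swMr V W (A : algType k) (a : A) (f : V -> W -> A) t :
  sw t f * a = \sw_(m, n <- t) (f m n * a).
Proof. exact: mulr_suml. Qed.

Lemma swZ V W U c (f : V -> W -> U) t :
  c *: sw t f = \sw_(m, n <- t) (c *: f m n).
Proof. exact: scaler_sumr. Qed.

Lemma sw_tenl V W U X (u : X) (f : V -> W -> U) t :
  sw t f \ox u = \sw_(m, n <- t) (f m n \ox u).
Proof. by rewrite (lin_sw (F := fun x => x \ox u)) //; apply: lin_tenl. Qed.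

Lemma sw_tenr V W U X (u : X) (f : V -> W -> U) t :
  u \ox sw t f = \sw_(m, n <- t) (u \ox f m n).
Proof. by rewrite (lin_sw (F := fun x => u \ox x)) //; apply: lin_tenr. Qed.

Lemma lin_sw_fun V W U X (f : V -> W -> U -> X) t :
  (forall m n, linear (fun v => f v m n)) -> linear (fun v => sw t (f v)).
Proof. by move=> lf; apply: lin_sum => p; apply: lf. Qed.

Lemma sw_ten V W U (f : V -> W -> U) v w : bilin f -> sw (v \ox w) f = f v w.
Proof. by move=> /bilin_balanced; apply: tliftE. Qed.

Lemma sw_linear V W U (f : V -> W -> U) : bilin f -> linear (fun t => sw t f).
Proof.
move=> bf c t u; have bb := bilin_balanced bf; rewrite /sw (tliftD _ _ bb).
congr (_ + _); elim/tensor_ind: t => [|v w t IH].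
  by rewrite scaler0 (tlift0 bb) scaler0.
rewrite scalerDr !(tliftD _ _ bb) scalerDr IH -tenZl -!/(sw _ _) !sw_ten //.
by case: bf => fl _; rewrite (linZ (fl w)).
Qed.

Lemma lin_sw_arg V W U X (f : V -> W -> U) (F : X -> tensor V W) :
  bilin f -> linear F -> linear (fun x => sw (F x) f).
Proof. by move=> bf; apply: lin_comp; apply: sw_linear. Qed.

Lemma sw_id V W (t : tensor V W) : \sw_(v, w <- t) (v \ox w) = t.
Proof.
have bb : bilin (@ten k V W) by split=> ?; [apply: lin_tenl|apply: lin_tenr].
elim/tensor_ind: t => [|v w t IH]; first exact: lin0 (sw_linear bb).
by rewrite (linD (sw_linear bb)) sw_ten // IH.
Qed.

Lemma eq_linear_tensor V W U (F G : tensor V W -> U) : linear F -> linear G ->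
  (forall v w, F (v \ox w) = G (v \ox w)) -> F =1 G.
Proof.
move=> lF lG FG; elim/tensor_ind => [|v w t IH]; first by rewrite !lin0.
by rewrite (linD lF) (linD lG) FG IH.
Qed.

Lemma sw_sw V W U X Y (f : V -> W -> U) (t : tensor X Y) (g : X -> Y -> tensor V W) :
  bilin f -> sw (\sw_(m, n <- t) g m n) f = \sw_(m, n <- t) sw (g m n) f.
Proof. by move=> bf; apply: (lin_sw (F := fun t => sw t f)); apply: sw_linear. Qed.

Lemma tmapE V W V' W' (a : V -> V') (b : W -> W') t :
  tmap a b t = \sw_(v, w <- t) (a v \ox b w).
Proof. by []. Qed.

Lemma tmulE (A B : algType k) (t u : tensor A B) :
  tmul t u = \sw_(a, b <- t) \sw_(a', b' <- u) ((a * a') \ox (b * b')).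
Proof. by []. Qed.

Lemma tassocE V W U (t : tensor (tensor V W) U) :
  tassoc t = \sw_(x, u <- t) \sw_(v, w <- x) (v \ox (w \ox u)).
Proof. by []. Qed.

Lemma sw_tmap V W V' W' U (f : V' -> W' -> U) (a : V -> V') (b : W -> W') t :
  bilin f -> sw (tmap a b t) f = \sw_(v, w <- t) f (a v) (b w).
Proof. by move=> bf; rewrite tmapE sw_sw //; apply: eq_sw => v w; apply: sw_ten. Qed.

Lemma sw_tmul (A B : algType k) U (f : A -> B -> U) t u : bilin f ->
  sw (tmul t u) f = \sw_(a, b <- t) \sw_(a', b' <- u) f (a * a') (b * b').
Proof.
move=> bf; rewrite tmulE sw_sw //; apply: eq_sw => a b.
by rewrite sw_sw //; apply: eq_sw => a' b'; apply: sw_ten.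
Qed.

Lemma sw_tassoc V W U X (f : V -> W -> U -> X) (t : tensor (tensor V W) U) :
  trilin f ->
  \sw_(v, y <- tassoc t) \sw_(w, u <- y) f v w u =
  \sw_(x, u <- t) \sw_(v, w <- x) f v w u.
Proof.
move=> [f1 f2 f3].
have bf v : bilin (f v) by split.
have bg : bilin (fun v y => sw y (f v)).
  by split=> [y|v]; [apply: lin_sw_fun|apply: sw_linear].
rewrite tassocE sw_sw //; apply: eq_sw => x u.
rewrite sw_sw //; apply: eq_sw => v w.
by rewrite sw_ten // sw_ten.
Qed.

Lemma lin_tmap V W V' W' (a : V -> V') (b : W -> W') :
  linear a -> linear b -> linear (tmap a b).
Proof.
move=> la lb; apply: (sw_linear (f := fun v w => a v \ox b w)).
by split=> ?; [apply: lin_tenl|apply: lin_tenr].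
Qed.

Lemma lin_tassoc V W U : linear (@tassoc k V W U).
Proof.
apply: (sw_linear (f := fun x u => \sw_(v, w <- x) (v \ox (w \ox u)))).
split=> [u|x]; last by apply: lin_sw_fun => v w; do 2!apply: lin_tenr.
by apply: sw_linear; split=> ?; [apply: lin_tenl|apply/lin_tenr/lin_tenl].
Qed.

Lemma tmap_ten V W V' W' (a : V -> V') (b : W -> W') v w :
  linear a -> linear b -> tmap a b (v \ox w) = a v \ox b w.
Proof.
move=> la lb; apply: (sw_ten (f := fun v w => a v \ox b w)).
by split=> ?; [apply: lin_tenl|apply: lin_tenr].
Qed.

Lemma tassoc_ten V W U (x : tensor V W) (u : U) :
  tassoc (x \ox u) = \sw_(v, w <- x) (v \ox (w \ox u)).
Proof.
apply: (sw_ten (f := fun x u => \sw_(v, w <- x) (v \ox (w \ox u)))).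
split=> [y|y]; last by apply: lin_sw_fun => v w; do 2!apply: lin_tenr.
by apply: sw_linear; split=> ?; [apply: lin_tenl|apply/lin_tenr/lin_tenl].
Qed.

End Sw.

Section FieldScaling.
Variable k : fieldType.
Implicit Types a b c : k.

Lemma scale_field a b c : a *: (b * c : k^o) = c *: (b *: (a : k^o)).
Proof. by have E : a * (b * c) = c * (b * a) by rewrite mulrC mulrAC mulrC. Qed.

Lemma scale_fieldC a b : a *: (b : k^o) = b *: (a : k^o).
Proof. by have E : a * b = b * a by rewrite mulrC. Qed.

Lemma scale_fieldA (V : lmodType k) a b (z : V) :
  ((a *: (b : k^o) : k^o) : k) *: z = a *: (b *: z).
Proof. by rewrite scalerA. Qed.

End FieldScaling.

(** * The pairing of a space of functionals with the Hopf algebra *)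

Lemma lin_ev (k : fieldType) (H : hopfAlgType k) (V : lmodType k)
    (u : fdual H) (F : V -> H) :
  linear F -> linear (fun v => ev u (F v) : k^o).
Proof. by move=> lF c v w; rewrite lF ev_linear. Qed.

Section Pair.
Variables (k : fieldType) (H : hopfAlgType k) (g : submodClosed (fdual H)).
Local Notation G := (subspace g).
Implicit Types (u v : G) (h x y : H).

(** The values are taken in [k^o] so that linearity in either argument can be
    stated. *)
Definition pair u h : k^o := ev (sub_incl u) h.

Lemma pair_bilin : bilin pair.
Proof. by split=> [h c u v|u]; [rewrite /pair linearP evP|exact: ev_linear]. Qed.

Lemma lin_pairr (V : lmodType k) u (F : V -> H) :
  linear F -> linear (fun w => pair u (F w)).
Proof. by move=> lF c w w'; rewrite /pair lF ev_linear. Qed.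

Lemma lin_pairl (V : lmodType k) h (F : V -> G) :
  linear F -> linear (fun w => pair (F w) h).
Proof. exact: lin_comp (pair_bilin.1 h). Qed.

Lemma pair_inj u v : pair u =1 pair v -> u = v.
Proof. by move=> uv; apply/val_inj/fdualP. Qed.

End Pair.

(** Linearity of an expression in one variable, by recursion on the expression;
    for the functions known to be linear it looks in the context. *)
Ltac lin := intros; cbv beta;
  lazymatch goal with
  | |- bilin _ => split; lin
  | |- trilin _ => split; lin
  | _ => first
    [ solve [auto 2] | exact: lin_id | exact: linearP
    | apply: linMl; lin | apply: linMr; lin
    | apply: lin_scaler; lin | apply: lin_scalel; lin
    | apply: lin_add; lin
    | apply: lin_tenl; lin | apply: lin_tenr; lin
    | apply: lin_sw_fun; lin | apply: lin_sw_arg; lin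
    | apply: lin_pairl; lin | apply: lin_pairr; lin | apply: lin_ev; lin
    | apply: (lin_comp (linearP comul)); lin
    | apply: (lin_comp (linearP counit)); lin
    | apply: (lin_comp (linearP antipode)); lin
    | match goal with lG : _ |- _ =>
        first [apply: (lin_comp lG); lin | apply: (lin_comp (lG _)); lin] end ]
  end.

Section Nondegenerate.
Variables (k : fieldType) (H : hopfAlgType k) (g : submodClosed (fdual H)).
Local Notation G := (subspace g).

(** The pairing separates the points of [g], so a tensor of [g ⊗ V] that it kills
    in the first factor is zero.  A bilinear [f] in place of [⊗] covers both
    [g ⊗ V] and [V ⊗ g].  If some [u] of the sum is nonzero at [h0], the
    hypothesis at [h0] expresses its partner through the others, and the sum
    becomes one with fewer terms. *)
Lemma pair_nondeg (V W : lmodType k) (f : G -> V -> W) (s : seq (G * V)) : bilin f ->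
  (forall h, \sum_(p <- s) (pair p.1 h : k) *: p.2 = 0) ->
  \sum_(p <- s) f p.1 p.2 = 0.
Proof.
move=> [fl fr]; have [n] := ubnP (size s).
elim: n s => // n IH [|[u w] s] sn s0; first by rewrite big_nil.
rewrite big_cons /=; have [u0|/existsNP[h0 /eqP u0]] := pselect (forall h, pair u h = 0).
  have -> : u = 0.
    by apply: pair_inj => h; rewrite u0 (lin0 ((pair_bilin g).1 h)).
  rewrite (lin0 (fl w)) add0r; apply: IH => // h.
  by have := s0 h; rewrite big_cons u0 scale0r add0r.
pose a (p : G * V) : k := pair p.1 h0 / pair u h0.
have wE : w = - \sum_(p <- s) a p *: p.2.
  have /(congr1 ( *:%R (pair u h0)^-1)) := s0 h0.
  rewrite big_cons /= scalerDr scalerA mulVf // scale1r scaler0 => /eqP.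
  rewrite addr_eq0 => /eqP {1}->; rewrite scaler_sumr; congr (- _).
  by apply: eq_bigr => p _; rewrite scalerA mulrC.
have red (U : lmodType k) (F : G -> V -> U) : bilin F -> F u w + \sum_(p <- s) F p.1 p.2 =
    \sum_(p <- [seq (p.1 - a p *: u, p.2) | p <- s]) F p.1 p.2.
  move=> [Fl Fr]; rewrite big_map wE -scaleN1r (linZ (Fr u)) scaleN1r.
  rewrite (lin_bigsum _ _ _ (Fr u)) addrC -sumrB; apply: eq_bigr => p _.
  by rewrite (linZ (Fr u)) (linB (Fl _)) (linZ (Fl _)).
rewrite red //; apply: IH; first by rewrite size_map.
move=> h; rewrite -(red _ (fun v w => (pair v h : k) *: w)).
  by have := s0 h; rewrite big_cons.
by lin.
Qed.

End Nondegenerate.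

Section PairingTensor.
Variables (k : fieldType) (H : hopfAlgType k) (g : submodClosed (fdual H)).
Local Notation G := (subspace g).
Variable V : lmodType k.

Lemma sw_pair_inj (t t' : tensor G V) :
  (forall h, \sw_(u, v <- t) ((pair u h : k) *: v) =
             \sw_(u, v <- t') ((pair u h : k) *: v)) -> t = t'.
Proof.
move=> tt'; apply/subr0_eq; rewrite -[t - t']sw_id; apply: pair_nondeg.
  by lin.
have bp h : bilin (fun (u : G) (v : V) => (pair u h : k) *: v) by lin.
by move=> h; have := linB (sw_linear (bp h)) t t'; rewrite tt' subrr.
Qed.

Lemma sw_pairC_inj0 (t : tensor V G) :
  (forall h, \sw_(v, u <- t) ((pair u h : k) *: v) = 0) -> t = 0.
Proof.
move=> t0; rewrite -[t]sw_id /sw /tlift.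
have := @pair_nondeg k H g V (tensor V G) (fun u v => v \ox u)
  [seq (p.2, p.1) | p <- repr t].
rewrite big_map /=; apply; first by lin.
by move=> h; rewrite big_map; apply: t0.
Qed.

End PairingTensor.

(** * Sweedler calculus in a Hopf algebra *)

Section Hopf.
Variables (k : fieldType) (H : hopfAlgType k).
Implicit Types (V : lmodType k) (x y h : H).

Section Coaction.
Variables (M : lmodType k) (rho : M -> tensor M H).
Hypothesis rhoP : right_coaction rho.

Lemma sw_coactA V (F : M -> H -> H -> V) m : trilin F ->
  \sw_(m0, h <- rho m) \sw_(m00, m01 <- rho m0) F m00 m01 h =
  \sw_(m0, h <- rho m) \sw_(h1, h2 <- comul h) F m0 h1 h2.
Proof.
move=> [f1 f2 f3]; have bF z : bilin (F z) by lin.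
have lrho := coact_linear rhoP.
have := congr1 (fun t => \sw_(v, y <- t) \sw_(a, b <- y) F v a b) (coactA rhoP m).
rewrite /= sw_tassoc // !sw_tmap; first by [].
- by lin.
- by lin.
Qed.

Lemma sw_coact1 V (F : M -> V) m : linear F ->
  \sw_(m0, h <- rho m) ((counit h : k) *: F m0) = F m.
Proof.
move=> lF; rewrite -{2}(coact1 rhoP m) lin_sw //.
by apply: eq_sw => m0 h; rewrite linZ.
Qed.

End Coaction.

Lemma comul_coaction : right_coaction (comul : H -> tensor H H).
Proof. by split; [apply: linearP | apply: comulA | apply: counitr]. Qed.

Lemma sw_comulA V (F : H -> H -> H -> V) h : trilin F ->
  \sw_(x, y <- comul h) \sw_(a, b <- comul x) F a b y =
  \sw_(x, y <- comul h) \sw_(a, b <- comul y) F x a b.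
Proof. exact: sw_coactA comul_coaction _ _ _. Qed.

Lemma sw_counitr V (F : H -> V) h : linear F ->
  \sw_(x, y <- comul h) ((counit y : k) *: F x) = F h.
Proof. exact: sw_coact1 comul_coaction _ _ _. Qed.

Lemma sw_counitl V (F : H -> V) h : linear F ->
  \sw_(x, y <- comul h) ((counit x : k) *: F y) = F h.
Proof.
move=> lF; rewrite -{2}(counitl h) lin_sw //.
by apply: eq_sw => x y; rewrite linZ.
Qed.

Lemma sw_comulM V (F : H -> H -> V) x y : bilin F ->
  sw (comul (x * y)) F =
  \sw_(x1, x2 <- comul x) \sw_(y1, y2 <- comul y) F (x1 * y1) (x2 * y2).
Proof. by move=> bF; rewrite comulM sw_tmul. Qed.

Lemma sw_antipodel V (F : H -> V) h : linear F ->
  \sw_(x, y <- comul h) F (antipode x * y) = (counit h : k) *: F 1.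
Proof. by move=> lF; rewrite -linZ // -antipodel lin_sw. Qed.

Lemma sw_antipoder V (F : H -> V) h : linear F ->
  \sw_(x, y <- comul h) F (x * antipode y) = (counit h : k) *: F 1.
Proof. by move=> lF; rewrite -linZ // -antipoder lin_sw. Qed.

Section Diagonal.
Variables (M N : lmodType k) (rhoM : M -> tensor M H) (rhoN : N -> tensor N H).
Hypotheses (rhoMP : right_coaction rhoM) (rhoNP : right_coaction rhoN).

(* Linearity facts for [lin] to find. *)
Let lM := coact_linear rhoMP.
Let lN := coact_linear rhoNP.

Lemma bilin_diag_coaction : bilin (fun m n =>
  \sw_(m0, m1 <- rhoM m) \sw_(n0, n1 <- rhoN n) ((m0 \ox n0) \ox (m1 * n1))).
Proof. by lin. Qed.

Lemma diag_coaction_ten m n : diag_coaction rhoM rhoN (m \ox n) =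
  \sw_(m0, m1 <- rhoM m) \sw_(n0, n1 <- rhoN n) ((m0 \ox n0) \ox (m1 * n1)).
Proof. exact: sw_ten bilin_diag_coaction. Qed.

Lemma lin_diag_coaction : linear (diag_coaction rhoM rhoN).
Proof. exact: sw_linear bilin_diag_coaction. Qed.

Lemma diag_right_coaction : right_coaction (diag_coaction rhoM rhoN).
Proof.
have lD := lin_diag_coaction.
split=> // t.
  move: t; apply: (eq_linear_tensor
    (F := fun t => tassoc (tmap _ id (diag_coaction rhoM rhoN t)))
    (G := fun t => tmap id comul (diag_coaction rhoM rhoN t))).
  - by apply/lin_comp/lin_comp; [apply: lin_tassoc | apply: lin_tmap; first exact: lD |].
  - by apply: lin_comp => //; apply: lin_tmap => //; apply: linearP.
  move=> m n; rewrite diag_coaction_ten.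
  transitivity (\sw_(m0, m1 <- rhoM m) \sw_(m00, m01 <- rhoM m0)
    \sw_(n0, n1 <- rhoN n) \sw_(n00, n01 <- rhoN n0)
      ((m00 \ox n00) \ox ((m01 * n01) \ox (m1 * n1)))).
    rewrite tmapE sw_sw; last by lin.
    rewrite (lin_sw _ _ (@lin_tassoc _ _ _ _)); apply: eq_sw => m0 m1.
    rewrite sw_sw; last by lin.
    rewrite (lin_sw _ _ (@lin_tassoc _ _ _ _)) exchange_sw; apply: eq_sw => n0 n1.
    rewrite sw_ten; last by lin.
    rewrite tassoc_ten diag_coaction_ten sw_sw; last by lin.
    apply: eq_sw => m00 m01; rewrite sw_sw; last by lin.
    by apply: eq_sw => n00 n01; rewrite sw_ten //; lin.
  rewrite (sw_coactA rhoMP (F := fun m0 m1 m2 =>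
    \sw_(n0, n1 <- rhoN n) \sw_(n00, n01 <- rhoN n0)
      ((m0 \ox n00) \ox ((m1 * n01) \ox (m2 * n1))))); last by lin.
  rewrite tmapE sw_sw; last by lin.
  apply: eq_sw => m0 m1; rewrite sw_sw; last by lin.
  under eq_sw => h1 h2.
    rewrite (sw_coactA rhoNP (F := fun n0 n1 n2 =>
      (m0 \ox n0) \ox ((h1 * n1) \ox (h2 * n2)))); last by lin.
    over.
  rewrite exchange_sw; apply: eq_sw => n0 n1.
  rewrite sw_ten; last by lin.
  rewrite comulM tmulE !sw_tenr; apply: eq_sw => h1 h2.
  by rewrite sw_tenr.
move: t; apply: (eq_linear_tensor (F := fun t =>
  \sw_(x, h <- diag_coaction rhoM rhoN t) ((counit h : k) *: x))); first by lin.
- by [].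
move=> m n; rewrite diag_coaction_ten sw_sw; last by lin.
under eq_sw => m0 m1.
  rewrite sw_sw; last by lin.
  under eq_sw => n0 n1.
    rewrite sw_ten; last by lin.
    rewrite counitM mulrC -scalerA -tenZl -tenZr; over.
  by rewrite -sw_tenr (sw_coact1 rhoNP n (@lin_id _ _)); over.
by rewrite -sw_tenl (sw_coact1 rhoMP m (@lin_id _ _)).
Qed.

End Diagonal.

End Hopf.

(** * Faithfulness of the twisted pairing *)

Section TwistedPairing.
Variables (k : fieldType) (H : hopfAlgType k) (g : submodClosed (fdual H)).
Local Notation G := (subspace g).
Variable V : lmodType k.

(** The untwisted values of the pairing are recovered by convolution with the
    antipode: [Σ u(h) v = Σ u(h_1) v h_2 S(h_3)]. *)
Lemma twisted_pair_inj (r : V -> H -> V) (t t' : tensor G V) :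
  bilin r -> (forall v, r v 1 = v) -> (forall v x y, r (r v x) y = r v (x * y)) ->
  (forall h, \sw_(h1, h2 <- comul h) \sw_(u, v <- t) ((pair u h1 : k) *: r v h2) =
             \sw_(h1, h2 <- comul h) \sw_(u, v <- t') ((pair u h1 : k) *: r v h2)) ->
  t = t'.
Proof.
move=> br r1 rM tt'; have [rl rr] := br.
suff E (z : tensor G V) h : \sw_(u, v <- z) ((pair u h : k) *: v) =
    \sw_(p, q <- comul h) r (\sw_(h1, h2 <- comul p) \sw_(u, v <- z)
      ((pair u h1 : k) *: r v h2)) (antipode q).
  by apply: sw_pair_inj => h; rewrite !E; apply: eq_sw => p q; rewrite tt'.
under [RHS]eq_sw => p q.
  rewrite (lin_sw _ _ (rl (antipode q))).
  under eq_sw => h1 h2.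
    rewrite (lin_sw _ _ (rl (antipode q))).
    under eq_sw => u v do rewrite (linZ (rl (antipode q))) rM.
    over.
  over.
rewrite (sw_comulA (F := fun h1 h2 q => \sw_(u, v <- z)
  ((pair u h1 : k) *: r v (h2 * antipode q)))); last by lin.
under [RHS]eq_sw => h1 q.
  rewrite exchange_sw.
  under eq_sw => u v.
    rewrite -swZ (sw_antipoder (F := r v)) // r1 scalerA mulrC -scalerA.
    over.
  rewrite -swZ; over.
by rewrite (sw_counitr (F := fun h => \sw_(u, v <- z) ((pair u h : k) *: v))) //; lin.
Qed.

End TwistedPairing.

(** * Subalgebras that contain the image of the antipode *)

Section Convolution.
Variables (k : fieldType) (H : hopfAlgType k).
Implicit Types (x y h : H) (f : H -> H).

Definition conv f f' : H -> H := fun h => \sw_(x, y <- comul h) (f x * f' y).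
Definition conv1 : H -> H := fun h => (counit h : k) *: 1.

Lemma lin_conv f f' : linear f -> linear f' -> linear (conv f f').
Proof.
by move=> lf lf'; apply: lin_sw_arg; [split=> ?; [apply: linMr|apply: linMl]|apply: linearP].
Qed.

Lemma lin_conv1 : linear conv1.
Proof. by rewrite /conv1; lin. Qed.

Lemma convA f f' f'' : linear f -> linear f' -> linear f'' ->
  conv f (conv f' f'') = conv (conv f f') f''.
Proof.
move=> lf lf' lf''; apply/funext => h; rewrite /conv.
under eq_sw do rewrite swMl; under [RHS]eq_sw do rewrite swMr.
rewrite (sw_comulA (F := fun x y z => f x * f' y * f'' z)).
  by do 2!apply: eq_sw => *; rewrite mulrA.
split=> *; [do 2!apply: linMr|apply: linMr; apply: linMl|apply: linMl]; exact.
Qed.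

Lemma conv1f f : linear f -> conv conv1 f = f.
Proof.
move=> lf; apply/funext => h; rewrite /conv /conv1.
by under eq_sw do rewrite -scalerAl mul1r; rewrite sw_counitl.
Qed.

Lemma convf1 f : linear f -> conv f conv1 = f.
Proof.
move=> lf; apply/funext => h; rewrite /conv /conv1.
by under eq_sw do rewrite -scalerAr mulr1; rewrite sw_counitr.
Qed.

Lemma conv_id_antipode : conv id antipode = conv1.
Proof. by apply/funext => h; rewrite /conv (sw_antipoder (F := id)). Qed.

Definition conv_exp f n := iter n (conv f) conv1.

Lemma lin_conv_exp f n : linear f -> linear (conv_exp f n).
Proof.
by move=> lf; elim: n => [|n IH]; [apply: lin_conv1|apply: lin_conv].
Qed.

Lemma conv_exp_cancel f f' n m : linear f -> linear f' -> conv f f' = conv1 ->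
  conv (conv_exp f n) (conv_exp f' (n + m)) = conv_exp f' m.
Proof.
move=> lf lf' ff'; have le i := lin_conv_exp i lf; have le' i := lin_conv_exp i lf'.
elim: n m => [|n IH] m; first by rewrite conv1f.
have eS g i : conv_exp g i.+1 = conv g (conv_exp g i) by [].
have eSr i : conv_exp f i.+1 = conv (conv_exp f i) f.
  by elim: i => [|i IHi]; rewrite eS ?convf1 ?conv1f // {1}IHi convA.
rewrite eSr -convA // addSn eS.
by rewrite [conv f (conv f' _)]convA // ff' conv1f // IH.
Qed.

End Convolution.

Section Approximation.
Variables (k : fieldType) (H : hopfAlgType k).

Record subalgebra (R : H -> Prop) : Prop := {
  subalg1 : R 1;
  subalg_lin : forall c x y, R x -> R y -> R (c *: x + y);
  subalgM : forall x y, R x -> R y -> R (x * y) }.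

Lemma ideal_scale (I : H -> Prop) c x : two_sided_ideal I -> I x -> I (c *: x).
Proof. by move=> iI Ix; rewrite -[x]mul1r scalerAl; apply: (Defs.idealMl iI). Qed.

Lemma ideal_sum (I : H -> Prop) J (r : seq J) (P : pred J) (F : J -> H) :
  two_sided_ideal I -> (forall j, I (F j)) -> I (\sum_(j <- r | P j) F j).
Proof. by move=> iI IF; apply: big_ind => // *; [apply: (ideal0 iI)|apply: (idealD iI)]. Qed.

Lemma subalg0 R : subalgebra R -> R 0.
Proof. by move=> sR; rewrite -(addNr 1) -scaleN1r; apply: (subalg_lin sR); apply: (subalg1 sR). Qed.

Lemma subalgZ R c x : subalgebra R -> R x -> R (c *: x).
Proof. by move=> sR Rx; rewrite -[_ *: _]addr0; apply: (subalg_lin sR) => //; apply: subalg0. Qed.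

Lemma subalg_sum R J (r : seq J) (P : pred J) (F : J -> H) :
  subalgebra R -> (forall j, P j -> R (F j)) -> R (\sum_(j <- r | P j) F j).
Proof.
move=> sR RF; apply: big_ind => // [|x y Rx Ry]; first exact: subalg0.
by rewrite -[x]scale1r; apply: (subalg_lin sR).
Qed.

Lemma subalg_conv_exp R f n h : subalgebra R -> (forall x, R (f x)) ->
  R (conv_exp f n h).
Proof.
move=> sR Rf; elim: n h => [|n IH] h; first by apply: subalgZ (subalg1 sR).
apply: subalg_sum => // -[x y] _; exact: (subalgM sR (Rf x) (IH y)).
Qed.

(** The row [v] is a nontrivial relation modulo [I] between the convolution powers
    of [S] at the second legs of [Δ(h)].  Convolution with a power of the identity,
    whose convolution inverse is [S], turns its lowest term into a multiple of [h]
    and the others into values of powers of [S]. *)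
Lemma antipode_approx (I : H -> Prop) (R : H -> Prop) :
  two_sided_ideal I -> finite_codim I ->
  subalgebra R -> (forall h, R (antipode h)) ->
  forall h, exists2 r, R r & I (h - r).
Proof.
move=> iI [N [p Ip]] sR RS h.
have [s hs] := btensorP (comul h : tensor H H).
pose b (i : 'I_(size s)) := (tnth (in_tuple s) i).2.
pose a (i : 'I_(size s)) := (tnth (in_tuple s) i).1.
have swE (f : H -> H -> H) : bilin f -> sw (comul h) f = \sum_i f (a i) (b i).
  move=> bf; rewrite [comul h]hs (lin_bigsum _ _ _ (sw_linear bf)) big_tnth.
  by apply: eq_bigr => i _; apply: sw_ten.
pose E m := conv_exp (antipode : H -> H) m.
have lE m : linear (E m) by apply/lin_conv_exp/linearP.
(* One more power than the dimension of the target, so a relation exists. *)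
pose d := (size s * N)%N.
pose X : 'M[k]_(d.+1, d) :=
  \matrix_(m < d.+1) mxvec (\matrix_(i < size s) p (E m (b i))).
have [v vX v0] : exists2 v : 'rV_d.+1, v *m X = 0 & v != 0.
  have /rowV0Pn[v /sub_kermxP vX v0] : kermx X != 0; last by exists v.
  rewrite kermx_eq0; apply/negP => /eqP rX.
  by have := rank_leq_col X; rewrite rX ltnn.
have vE i : I (\sum_m v 0 m *: E m (b i)).
  apply/Ip; rewrite linear_sum; move: vX; rewrite mulmx_sum_row.
  move=> /(congr1 vec_mx) /(congr1 (row i)); rewrite !linear_sum !linear0.
  move=> {2}<-; apply: eq_bigr => m _; rewrite !rowK !linearZ /=.
  by rewrite mxvecK rowK.
have [m1 vm1] : exists m, v 0 m != 0.
  by apply/existsP; apply: contraNT v0 => /existsPn v0; apply/eqP/rowP => m;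
     rewrite mxE; apply/eqP; rewrite -[_ == _]negbK v0.
have [m0 vm0 min0] := @arg_minnP _ m1 (fun m => v 0 m != 0) (fun m : 'I__ => m : nat) vm1.
pose w := conv_exp (id : H -> H) m0.+1.
have lid : linear (id : H -> H) by [].
have lw : linear w by apply: lin_conv_exp.
have lS : linear (antipode : H -> H) by apply: linearP.
have wE : I (\sum_m v 0 m *: conv w (E m) h).
  have -> : \sum_m v 0 m *: conv w (E m) h =
            \sum_i w (a i) * (\sum_m v 0 m *: E m (b i)).
    under [RHS]eq_bigr do rewrite mulr_sumr; rewrite exchange_big /=.
    apply: eq_bigr => m _; rewrite /conv swE; last first.
      by split=> ?; [apply: linMr|apply: linMl].
    by rewrite scaler_sumr; apply: eq_bigr => i _; rewrite scalerAr.
  by apply: ideal_sum => // i; apply: (Defs.idealMl iI).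
rewrite (bigD1 m0) //= in wE.
have ew0 : conv w (E m0) h = h.
  rewrite /w /conv_exp iterS -/(conv_exp _ _) -convA //; last exact: lin_conv_exp.
  have := conv_exp_cancel m0 0 lid lS (conv_id_antipode H).
  by rewrite addn0 => ->; rewrite convf1.
rewrite ew0 in wE.
pose T := \sum_(m | m != m0) v 0 m *: conv w (E m) h.
exists (- (v 0 m0)^-1 *: T); last first.
  rewrite scaleNr opprK; have := ideal_scale (v 0 m0)^-1 iI wE.
  by rewrite scalerDr scalerA mulVf // scale1r.
apply: subalgZ => //; apply: subalg_sum => // m mm0.
have [mlt|mge] := ltnP m m0.
  have -> : v 0 m = 0.
    by apply: contraTeq mlt => /min0; rewrite -leqNgt.
  by rewrite scale0r; apply: subalg0.
have {mm0}mgt : (m0 < m)%N by rewrite ltn_neqAle mge andbT eq_sym.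
apply: subalgZ => //.
have -> : conv w (E m) = E (m - m0.+1)%N.
  have := conv_exp_cancel m0.+1 (m - m0.+1) lid lS (conv_id_antipode H).
  by rewrite subnKC.
exact: subalg_conv_exp.
Qed.

Lemma common_ideal (s : seq (fdual H)) : exists I : H -> Prop,
  [/\ two_sided_ideal I, finite_codim I
    & forall u, u \in s -> forall h, I h -> ev u h = 0].
Proof.
elim: s => [|u s [I [iI fI uI]]].
  exists (fun=> True); split=> //; exists 0, (\0 : {linear H -> 'rV[k]_0}) => h.
  by split=> // _; apply: thinmx0.
have [u0 [J [iJ fJ uJ]]] := fd_predP _ (valP u).
exists (fun h => I h /\ J h); split; last first.
- move=> v; rewrite inE => /orP[/eqP-> h [_ /uJ]//|vs h [+ _]]; exact: uI.
- exact: finite_codim_setI.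
split.
- by split; [apply: ideal0 iI|apply: ideal0 iJ].
- by move=> x y [Ix Jx] [Iy Jy]; split; [apply: (idealD iI)|apply: (idealD iJ)].
- by move=> h x [Ix Jx]; split; [exact: (Defs.idealMl iI)|exact: (Defs.idealMl iJ)].
- by move=> h x [Ix Jx]; split; [exact: (Defs.idealMr iI h Ix)|exact: (Defs.idealMr iJ h Jx)].
Qed.

End Approximation.

(** * Injectivity from the Hopf-Galois condition *)

Section Galois.
Variables (k : fieldType) (H : hopfAlgType k) (A : algType k).
Variables (rho : A -> tensor A H) (Arho : comodule_algebra rho).
Hypothesis galois : hopf_galois rho.

Let rhoP := comodule_algebra_coaction Arho.
Let lrho := coact_linear rhoP.

Lemma sw_rhoM (V : lmodType k) (F : A -> H -> V) a b : bilin F ->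
  sw (rho (a * b)) F =
  \sw_(a0, a1 <- rho a) \sw_(b0, b1 <- rho b) F (a0 * b0) (a1 * b1).
Proof. by move=> bF; rewrite (comodule_algebraM Arho) sw_tmul. Qed.

Lemma sw_rho1 (V : lmodType k) (F : A -> H -> V) : bilin F -> sw (rho 1) F = F 1 1.
Proof. by move=> bF; rewrite (comodule_algebra1 Arho) sw_ten. Qed.

(** The Galois map with the factors of the first leg exchanged.  Its image need
    not be all of [A ⊗ H] when the antipode is not surjective. *)
Definition opp_galois_map (t : tensor A A) : tensor A H :=
  \sw_(b, c <- t) \sw_(b0, b1 <- rho b) ((b0 * c) \ox b1).

Definition opp_galois_coef (r : H) : Prop := exists t, opp_galois_map t = 1 \ox r.

Lemma bilin_opp_galois : bilin (fun b c : A => \sw_(b0, b1 <- rho b) ((b0 * c) \ox b1)).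
Proof. by lin. Qed.

Lemma lin_opp_galois : linear opp_galois_map.
Proof. exact/sw_linear/bilin_opp_galois. Qed.

(** If [Σ b'_0 c' ⊗ b'_1 = 1 ⊗ x] and [Σ b_0 c ⊗ b_1 = 1 ⊗ y], then
    [Σ b'_0 b_0 c c' ⊗ b'_1 b_1 = Σ b'_0 c' ⊗ b'_1 y = 1 ⊗ x y]. *)
Lemma opp_galois_coef_subalgebra : subalgebra opp_galois_coef.
Proof.
have bG := bilin_opp_galois; have lG := lin_opp_galois.
split.
- exists (1 \ox 1); rewrite /opp_galois_map sw_ten // sw_rho1 ?mulr1 //; lin.
- move=> c x y [t tx] [u uy]; exists (c *: t + u).
  by rewrite lin_opp_galois tx uy tenDr tenZr.
move=> x y [t tx] [u uy].
exists (\sw_(b', c' <- t) \sw_(b, c <- u) ((b' * b) \ox (c * c'))).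
rewrite (lin_sw _ _ lG).
transitivity (\sw_(b', c' <- t) \sw_(z, l <- opp_galois_map u)
    \sw_(b0, b1 <- rho b') ((b0 * z * c') \ox (b1 * l))).
  apply: eq_sw => b' c'; rewrite (lin_sw _ _ lG) /opp_galois_map sw_sw; last by lin.
  apply: eq_sw => b c; rewrite sw_ten // sw_rhoM; last by lin.
  rewrite sw_sw; last by lin.
  rewrite exchange_sw; apply: eq_sw => b0 b1; rewrite sw_ten; last by lin.
  by apply: eq_sw => b0' b1'; rewrite !mulrA.
rewrite uy.
transitivity (\sw_(z, l <- opp_galois_map t) (z \ox (l * y))).
  rewrite /opp_galois_map sw_sw; last by lin.
  apply: eq_sw => b' c'; rewrite sw_ten; last by lin.
  rewrite sw_sw; last by lin.
  by apply: eq_sw => b0 b1; rewrite sw_ten ?mulr1 //; lin.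
by rewrite tx sw_ten //; lin.
Qed.

(** The map [φ(a ⊗ l) = a_0 ⊗ a_1 S(l)] sends [b c_0 ⊗ c_1] to [b_0 c ⊗ b_1] and
    [1 ⊗ h] to [1 ⊗ S(h)]. *)
Lemma opp_galois_coef_antipode h : opp_galois_coef (antipode h).
Proof.
(* [galois_map t0] is a sum over the representative [repr t0]; the same pairs,
   read in [A ⊗ A], are sent to [1 ⊗ S(h)] by [opp_galois_map]. *)
have [t0] : exists t : btensor_coinv rho, galois_map t = (1 : A) \ox h.
  by have [g _ gK] := galois; exists (g (1 \ox h)).
rewrite /galois_map /tlift => e.
exists (\sum_(p <- repr t0) (p.1 \ox p.2)).
rewrite (lin_bigsum _ _ _ lin_opp_galois).
pose phi (t : tensor A H) := \sw_(a, l <- t) \sw_(a0, a1 <- rho a) (a0 \ox (a1 * antipode l)).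
have bphi : bilin (fun a l => \sw_(a0, a1 <- rho a) (a0 \ox (a1 * antipode l))) by lin.
have lphi : linear phi by exact: sw_linear bphi.
have : phi (1 \ox h) = 1 \ox antipode h.
  by rewrite /phi sw_ten // sw_rho1 ?mul1r //; lin.
move <-; rewrite -e (lin_bigsum _ _ _ lphi); apply: eq_bigr => -[b c] _ /=.
rewrite /opp_galois_map (sw_ten _ _ bilin_opp_galois).
rewrite [RHS](_ : _ = phi (\sw_(c0, c1 <- rho c) ((b * c0) \ox c1))) // (lin_sw _ _ lphi).
transitivity (\sw_(b0, b1 <- rho b) \sw_(c0, l <- rho c) \sw_(x, y <- comul l)
   ((b0 * c0) \ox (b1 * (x * antipode y)))).
  apply: eq_sw => b0 b1.
  under eq_sw => c0 l.
    rewrite (sw_antipoder (F := fun z => (b0 * c0) \ox (b1 * z))); last by lin.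
    over.
  rewrite (sw_coact1 rhoP (F := fun z => (b0 * z) \ox (b1 * 1))); last by lin.
  by rewrite mulr1.
under eq_sw => b0 b1.
  rewrite -(sw_coactA rhoP (F := fun c0 x y =>
    (b0 * c0) \ox (b1 * (x * antipode y)))); last by lin.
  over.
rewrite exchange_sw; apply: eq_sw => c0 c1.
rewrite /phi sw_ten // sw_rhoM; last by lin.
by do 2!apply: eq_sw => ? ?; rewrite !mulrA.
Qed.

(** If [X = Σ a ⊗ v] acts by zero, then [Σ v(l) a z = 0] for every [z ⊗ l] in the
    image of [opp_galois_map].  With [z = 1] this covers a subalgebra that
    contains the image of [S], hence every [h] up to a common ideal in the
    kernels of the [v]. *)
Lemma sw_pair_eq0_of_action (g : submodClosed (fdual H))
    (X : tensor A (subspace g)) :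
  (forall b, \sw_(a, v <- X) \sw_(b0, b1 <- rho b)
     ((pair v b1 : k) *: (a * b0)) = 0) ->
  forall h, \sw_(a, v <- X) ((pair v h : k) *: a) = 0.
Proof.
move=> X0 h.
have [s sX] := btensorP (X : tensor A (subspace g)).
have [I [iI fI sI]] := common_ideal [seq sub_incl p.2 | p <- s].
have [r [t tr] hr] := antipode_approx iI fI opp_galois_coef_subalgebra
  opp_galois_coef_antipode h.
have bX y : bilin (fun a (v : subspace g) => (pair v y : k) *: a) by lin.
have swX F : bilin F -> sw X F = \sum_(p <- s) F p.1 p.2.
  move=> bF; rewrite [X]sX (lin_bigsum _ _ _ (sw_linear bF)).
  by apply: eq_bigr => p _; apply: sw_ten.
transitivity (\sw_(a, v <- X) ((pair v r : k) *: a)).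
  rewrite !swX //; apply: eq_big_seq => p ps.
  have := sI _ (map_f _ ps) _ hr; rewrite (linB (@ev_linear _ _ _)) => /eqP.
  by rewrite subr_eq0 /pair => /eqP ->.
pose psi (y : tensor A H) := \sw_(z, l <- y) \sw_(a, v <- X) ((pair v l : k) *: (a * z)).
have bpsi : bilin (fun z l => \sw_(a, v <- X) ((pair v l : k) *: (a * z))) by lin.
have : psi (opp_galois_map t) = 0.
  rewrite /psi /opp_galois_map sw_sw //.
  rewrite [LHS]big1 // => -[b c] _ /=; rewrite sw_sw //.
  transitivity (0 * c); last by rewrite mul0r.
  rewrite -(X0 b) exchange_sw swMr; apply: eq_sw => b0 b1.
  rewrite sw_ten // swMr; apply: eq_sw => a v.
  by rewrite -scalerAl mulrA.
rewrite tr /psi sw_ten // => e; rewrite -[RHS]e.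
by apply: eq_sw => a v; rewrite mulr1.
Qed.

End Galois.

(** * The adjoint coaction on a tangent space *)

Section Adjoint.
Variables (k : fieldType) (H : hopfAlgType k) (g : submodClosed (fdual H)).
Local Notation G := (subspace g).
Implicit Types (u v : G) (h x y : H).

Lemma adE v h : ad (sub_incl v) h =
  \sw_(x, h3 <- comul h) \sw_(h1, h2 <- comul x) ((pair v h2 : k) *: (h1 * antipode h3)).
Proof.
rewrite [LHS](_ : _ = \sw_(x, h3 <- tmap comul id (comul h)) \sw_(h1, h2 <- x)
  ((pair v h2 : k) *: (h1 * antipode h3))) //.
by rewrite sw_tmap //; lin.
Qed.

(** [h_1 S(h_3) v(h_2) h_4 = v(h_2) h_1]. *)
Lemma sw_ad_mul v h : \sw_(p, q <- comul h) (ad (sub_incl v) p * q) =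
  \sw_(h1, h2 <- comul h) ((pair v h2 : k) *: h1).
Proof.
under eq_sw => p q.
  rewrite adE swMr; under eq_sw => x h3 do rewrite swMr.
  over.
rewrite (sw_comulA (F := fun x h3 q => \sw_(h1, h2 <- comul x)
  ((pair v h2 : k) *: (h1 * antipode h3) * q))); last by lin.
under [LHS]eq_sw => x y.
  rewrite exchange_sw; under eq_sw => h1 h2.
    under eq_sw => a b do rewrite -scalerAl -mulrA.
    rewrite (sw_antipodel (F := fun z => (pair v h2 : k) *: (h1 * z))); last by lin.
    rewrite mulr1; over.
  rewrite -swZ; over.
by rewrite (sw_counitr (F := fun x => \sw_(h1, h2 <- comul x) ((pair v h2 : k) *: h1))) //; lin.
Qed.

Variable delta : G -> tensor G H.
Hypothesis ldelta : linear delta.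
Hypothesis deltaE : forall v h,
  \sw_(v0, v1 <- delta v) ((pair v0 h : k) *: v1) = ad (sub_incl v) h.

Lemma sw_delta_mul v h :
  \sw_(h1, h2 <- comul h) \sw_(v0, v1 <- delta v) ((pair v0 h1 : k) *: (v1 * h2)) =
  \sw_(h1, h2 <- comul h) ((pair v h2 : k) *: h1).
Proof.
rewrite -sw_ad_mul; apply: eq_sw => h1 h2; rewrite -deltaE swMr.
by apply: eq_sw => v0 v1; rewrite scalerAl.
Qed.

(** The right [H]-module [H ⊗ H] on which [H] acts through [Δ]. *)
Lemma bilin_tensor_act : bilin (fun (w : tensor H H) (h : H) => tmul w (comul h)).
Proof.
have : bilin (fun (w : tensor H H) (h : H) =>
  \sw_(a, b <- w) \sw_(a', b' <- comul h) ((a * a') \ox (b * b'))) by lin.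
exact.
Qed.

(** Both axioms are tested against the pairing twisted by right multiplication,
    through [Δ] in the case of coassociativity, so that [sw_delta_mul] applies. *)
Lemma delta_coaction : right_coaction delta.
Proof.
have [ta1 ta2] := bilin_tensor_act; split=> // v; last first.
  apply: pair_inj => h.
  have lp := (pair_bilin g).1 h.
  rewrite -/(sw _ _) (lin_sw _ _ lp).
  have le : linear (counit : H -> k^o) by exact: linearP.
  rewrite -[RHS](sw_counitl (F := pair v) h (@ev_linear _ _ _)).
  transitivity (counit (\sw_(h1, h2 <- comul h) \sw_(v0, v1 <- delta v)
      ((pair v0 h1 : k) *: (v1 * h2))) : k^o); last first.
    rewrite sw_delta_mul (lin_sw _ _ le); apply: eq_sw => h1 h2.
    by rewrite (linZ le) scale_fieldC.
  rewrite (lin_sw _ _ le).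
  under [RHS]eq_sw => h1 h2.
    rewrite (lin_sw _ _ le).
    under eq_sw => v0 v1 do rewrite (linZ le) counitM scale_field.
    rewrite -swZ; over.
  rewrite (sw_counitr (F := fun h => \sw_(v0, v1 <- delta v)
    ((counit v1 : k) *: pair v0 h))); last by lin.
  by apply: eq_sw => v0 v1; rewrite (linZ lp).
apply: (twisted_pair_inj bilin_tensor_act) => [w|w x y|h].
- rewrite comul1 tmulE -[RHS]sw_id; apply: eq_sw => a b.
  by rewrite sw_ten ?mulr1 //; lin.
- rewrite comulM [LHS]tmulE [RHS]tmulE tmulE sw_sw; last by lin.
  apply: eq_sw => a b; rewrite sw_sw; last by lin.
  rewrite sw_tmul; last by lin.
  apply: eq_sw => x1 x2; rewrite sw_ten; last by lin.
  by apply: eq_sw => y1 y2; rewrite !mulrA.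
transitivity (\sw_(p, h3 <- comul h) \sw_(v0, v1 <- delta v)
  ((\sw_(h1, h2 <- comul p) \sw_(v00, v01 <- delta v0)
    ((pair v00 h1 : k) *: (v01 * h2))) \ox (v1 * h3))).
  under [RHS]eq_sw => p h3.
    under eq_sw => v0 v1.
      rewrite sw_tenl; under eq_sw => h1 h2 do rewrite sw_tenl.
      over.
    rewrite exchange_sw; over.
  rewrite (sw_comulA (F := fun h1 h2 h3 => \sw_(v0, v1 <- delta v)
    \sw_(v00, v01 <- delta v0) (((pair v00 h1 : k) *: (v01 * h2)) \ox (v1 * h3))));
    last by lin.
  apply: eq_sw => h1 q; rewrite tassocE sw_sw; last by lin.
  rewrite sw_tmap; last by lin.
  rewrite [RHS]exchange_sw; apply: eq_sw => v0 v1.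
  rewrite sw_sw; last by lin.
  rewrite [RHS]exchange_sw; apply: eq_sw => v00 v01.
  rewrite sw_ten; last by lin.
  rewrite tmulE sw_ten; last by lin.
  by rewrite swZ; apply: eq_sw => a b; rewrite tenZl.
transitivity (\sw_(x, y <- comul h) \sw_(a, b <- comul y) ((pair v b : k) *: (x \ox a))).
  under eq_sw => p h3.
    under eq_sw => v0 v1 do rewrite sw_delta_mul sw_tenl.
    rewrite exchange_sw; over.
  rewrite (sw_comulA (F := fun h1 h2 h3 => \sw_(v0, v1 <- delta v)
    (((pair v0 h2 : k) *: h1) \ox (v1 * h3)))); last by lin.
  apply: eq_sw => x y.
  transitivity (x \ox \sw_(a, b <- comul y) ((pair v b : k) *: a)); last first.
    by rewrite sw_tenr; apply: eq_sw => a b; rewrite tenZr.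
  rewrite -sw_delta_mul sw_tenr; apply: eq_sw => h2 h3.
  by rewrite sw_tenr; apply: eq_sw => v0 v1; rewrite tenZl tenZr.
rewrite -(sw_comulA (F := fun x a b => (pair v b : k) *: (x \ox a))); last by lin.
have lD : linear (comul : H -> tensor H H) by exact: linearP.
transitivity (comul (\sw_(h1, h2 <- comul h) ((pair v h2 : k) *: h1))).
  rewrite (lin_sw _ _ lD); apply: eq_sw => p q; rewrite (linZ lD).
  by rewrite -[comul p in RHS]sw_id swZ.
rewrite -sw_delta_mul (lin_sw _ _ lD); apply: eq_sw => h1 h2.
rewrite (lin_sw _ _ lD) sw_tmap; last by lin.
by apply: eq_sw => v0 v1; rewrite (linZ lD) comulM.
Qed.

(** In Sweedler notation [(v ◁ h_2)_0 ⊗ h_1 (v ◁ h_2)_1 = (v_0 ◁ h_1) ⊗ v_1 h_2].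
    Paired with [y] and twisted, both sides become
    [v(h_2 y_2) h_1 y_1 - v(h_2) h_1 y]. *)
Lemma delta_act (act : G -> H -> G) : bilin act ->
  (forall v x y, pair (act v x) y = pair v (x * y) - (counit y : k) *: pair v x) ->
  forall v h,
  \sw_(h1, h2 <- comul h) \sw_(w0, w1 <- delta (act v h2)) (w0 \ox (h1 * w1)) =
  \sw_(v0, v1 <- delta v) \sw_(h1, h2 <- comul h) (act v0 h1 \ox (v1 * h2)).
Proof.
move=> bact actE v h; have [lact1 lact2] := bact.
have bmul : bilin (fun x y : H => x * y) by lin.
apply: (twisted_pair_inj bmul) => [x|x y z|y]; [exact: mulr1|by rewrite mulrA|].
have bp y1 y2 : bilin (fun (u : G) (x : H) => (pair u y1 : k) *: (x * y2)) by lin.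
transitivity (\sw_(h1, h2 <- comul h) \sw_(y1, y2 <- comul y)
  ((pair v (h2 * y2) - (counit y2 : k) *: pair v h2 : k) *: (h1 * y1))).
  transitivity (\sw_(h1, h2 <- comul h) (h1 * \sw_(y1, y2 <- comul y)
      \sw_(w0, w1 <- delta (act v h2)) ((pair w0 y1 : k) *: (w1 * y2)))).
    under eq_sw => y1 y2 do rewrite sw_sw //.
    rewrite exchange_sw; apply: eq_sw => h1 h2; rewrite swMl; apply: eq_sw => y1 y2.
    rewrite sw_sw // swMl; apply: eq_sw => w0 w1.
    by rewrite sw_ten // -scalerAr mulrA.
  apply: eq_sw => h1 h2; rewrite sw_delta_mul swMl; apply: eq_sw => y1 y2.
  by rewrite actE -scalerAr.
transitivity (\sw_(v0, v1 <- delta v) \sw_(h1, h2 <- comul h) \sw_(y1, y2 <- comul y)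
  ((pair v0 (h1 * y1) - (counit y1 : k) *: pair v0 h1 : k) *: (v1 * h2 * y2))); last first.
  under [RHS]eq_sw => y1 y2 do rewrite sw_sw //.
  rewrite [RHS]exchange_sw; apply: eq_sw => v0 v1.
  under [RHS]eq_sw => y1 y2 do rewrite sw_sw //.
  rewrite [RHS]exchange_sw; apply: eq_sw => h1 h2; apply: eq_sw => y1 y2.
  by rewrite sw_ten // actE.
have split2 (X Y : lmodType k) (t : tensor X Y) (a b : X -> Y -> k) (z : X -> Y -> H) :
  \sw_(x1, x2 <- t) ((a x1 x2 - b x1 x2 : k) *: z x1 x2) =
  \sw_(x1, x2 <- t) (a x1 x2 *: z x1 x2) - \sw_(x1, x2 <- t) (b x1 x2 *: z x1 x2).
  by rewrite -swB; apply: eq_sw => *; rewrite scalerBl.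
under eq_sw => h1 h2 do rewrite split2.
under [RHS]eq_sw => v0 v1.
  under eq_sw => h1 h2 do rewrite split2.
  rewrite swB; over.
rewrite !swB; congr (_ - _).
  transitivity (\sw_(x, z <- comul (h * y)) ((pair v z : k) *: x)).
    by rewrite sw_comulM //; lin.
  rewrite -sw_delta_mul sw_comulM; last by lin.
  rewrite [RHS]exchange_sw; apply: eq_sw => h1 h2.
  rewrite [LHS]exchange_sw; apply: eq_sw => v0 v1; apply: eq_sw => y1 y2.
  by rewrite mulrA.
transitivity ((\sw_(h1, h2 <- comul h) ((pair v h2 : k) *: h1)) * y).
  rewrite swMr; apply: eq_sw => h1 h2; under eq_sw => y1 y2 do rewrite scale_fieldA.
  rewrite (sw_counitr (F := fun z => (pair v h2 : k) *: (h1 * z))); last by lin.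
  by rewrite scalerAl.
rewrite -sw_delta_mul swMr [RHS]exchange_sw; apply: eq_sw => h1 h2.
rewrite swMr; apply: eq_sw => v0 v1.
under [RHS]eq_sw => y1 y2 do rewrite scale_fieldA.
rewrite (sw_counitl (F := fun z => (pair v0 h1 : k) *: (v1 * h2 * z))); last by lin.
by rewrite -scalerAl.
Qed.

End Adjoint.

(** * The calculus on A ⊗ g *)

Section VectorFields.
Variables (k : fieldType) (H : hopfAlgType k) (A : algType k).
Variables (rho : A -> tensor A H) (Arho : comodule_algebra rho).
Variables (g : submodClosed (fdual H)) (gplus : forall u, u \in g -> ev u 1 = 0).
Local Notation G := (subspace g).
Local Notation X := (tensor A G).
Variable act : G -> H -> G.
Hypothesis bact : bilin act.
Hypothesis pair_act : forall v x y,
  pair (act v x) y = pair v (x * y) - (counit y : k) *: pair v x.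
Implicit Types (a b : A) (v : G) (h : H) (Y : X).

Let rhoP := comodule_algebra_coaction Arho.
Let lrho := coact_linear rhoP.
Let lact1 := bact.1.
Let lact2 := bact.2.

Lemma pair1 v : pair v 1 = 0.
Proof. exact: gplus (valP v). Qed.

Lemma act_1 v : act v 1 = v.
Proof. by apply: pair_inj => h; rewrite pair_act mul1r pair1 scaler0 subr0. Qed.

Lemma act_M v x y : act v (x * y) = act (act v x) y.
Proof.
apply: pair_inj => h; rewrite !pair_act counitM mulrA scalerBr opprB addrA.
by rewrite scalerA [counit h * _]mulrC subrK.
Qed.

Definition tangent_lact a Y : X := \sw_(b, v <- Y) ((a * b) \ox v).

Definition tangent_ract Y b : X :=
  \sw_(a, v <- Y) \sw_(b0, b1 <- rho b) ((a * b0) \ox act v b1).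

Lemma bilin_tangent_lact : bilin tangent_lact.
Proof. by rewrite /tangent_lact; lin. Qed.

Lemma bilin_tangent_ract : bilin tangent_ract.
Proof. by rewrite /tangent_ract; lin. Qed.

Lemma tangent_lact_ten a b v : tangent_lact a (b \ox v) = (a * b) \ox v.
Proof. by rewrite /tangent_lact sw_ten //; lin. Qed.

Lemma tangent_ract_ten a v b :
  tangent_ract (a \ox v) b = \sw_(b0, b1 <- rho b) ((a * b0) \ox act v b1).
Proof. by rewrite /tangent_ract sw_ten //; lin. Qed.

(* Linearity facts for [lin] to find. *)
Let ltl := bilin_tangent_lact.1.
Let ltr := bilin_tangent_lact.2.
Let rtl := bilin_tangent_ract.1.
Let rtr := bilin_tangent_ract.2.

Lemma tangent_lact1 Y : tangent_lact 1 Y = Y.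
Proof.
move: Y; apply: eq_linear_tensor; [by lin|by lin|] => a v.
by rewrite tangent_lact_ten mul1r.
Qed.

Lemma tangent_lactA a b Y : tangent_lact (a * b) Y = tangent_lact a (tangent_lact b Y).
Proof.
move: Y; apply: eq_linear_tensor; [by lin|by lin|] => c v.
by rewrite !tangent_lact_ten mulrA.
Qed.

Lemma tangent_ract1 Y : tangent_ract Y 1 = Y.
Proof.
move: Y; apply: eq_linear_tensor; [by lin|by lin|] => a v.
by rewrite tangent_ract_ten (sw_rho1 Arho) ?mulr1 ?act_1 //; lin.
Qed.

Lemma tangent_ractA Y a b : tangent_ract Y (a * b) = tangent_ract (tangent_ract Y a) b.
Proof.
move: Y; apply: eq_linear_tensor; [by lin|by lin|] => c v.
rewrite !tangent_ract_ten (sw_rhoM Arho); last by lin.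
rewrite (lin_sw _ _ (rtl b)); apply: eq_sw => a0 a1.
rewrite tangent_ract_ten; apply: eq_sw => b0 b1.
by rewrite mulrA act_M.
Qed.

Lemma tangent_lract a Y b :
  tangent_lact a (tangent_ract Y b) = tangent_ract (tangent_lact a Y) b.
Proof.
move: Y; apply: eq_linear_tensor; [by lin|by lin|] => c v.
rewrite tangent_lact_ten !tangent_ract_ten (lin_sw _ _ (ltr a)).
by apply: eq_sw => b0 b1; rewrite tangent_lact_ten mulrA.
Qed.

Definition tangent_bimodule : bimodule A X :=
  Bimodule bilin_tangent_lact.1 bilin_tangent_lact.2
           bilin_tangent_ract.1 bilin_tangent_ract.2
           tangent_lact1 tangent_lactA tangent_ract1 tangent_ractA tangent_lract.

Local Notation L := (@tangent_action k H A rho g).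

Lemma tangent_actionE Y b :
  L Y b = \sw_(a, v <- Y) (a * \sw_(b0, b1 <- rho b) ((pair v b1 : k) *: b0)).
Proof. by []. Qed.

Lemma bilin_tangent_action : bilin L.
Proof.
split=> [b|Y].
  by apply: (sw_linear (f := fun a v => a * \sw_(b0, b1 <- rho b) ((pair v b1 : k) *: b0))); lin.
have : linear (fun b => \sw_(a, v <- Y) (a * \sw_(b0, b1 <- rho b) ((pair v b1 : k) *: b0))) by lin.
exact.
Qed.

Lemma tangent_action_ten a v b :
  L (a \ox v) b = \sw_(b0, b1 <- rho b) ((pair v b1 : k) *: (a * b0)).
Proof.
rewrite tangent_actionE sw_ten; last by lin.
by rewrite swMl; apply: eq_sw => *; rewrite scalerAr.
Qed.

(** [a b_0 c_0 v(b_1 c_1)] splits by the definition of [v ◁ b_1] evaluated at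
    [c_1]; the term [v(b_1) ε(c_1)] gives [L_(a ⊗ v)(b) c]. *)
Lemma tangent_leibniz Y a b : L Y (a * b) = L Y a * b + L (tangent_ract Y a) b.
Proof.
have [l1 l2] := bilin_tangent_action.
move: Y; apply: eq_linear_tensor.
- exact: l1.
- by lin.
move=> c v; rewrite !tangent_action_ten tangent_ract_ten (sw_rhoM Arho); last by lin.
rewrite (lin_sw _ _ (l1 b)) swMr -swD; apply: eq_sw => a0 a1.
rewrite tangent_action_ten.
rewrite -{2}[b](sw_coact1 rhoP b (@lin_id _ _)) swMl -swD; apply: eq_sw => b0 b1.
rewrite pair_act scalerBl scale_fieldA -scalerAl -scalerAr !mulrA.
by rewrite [X in _ = X + _]scalerA [X in _ = X *: _ + _]mulrC -scalerA addrC subrK.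
Qed.

Lemma tangent_action_inj : hopf_galois rho -> injective L.
Proof.
move=> gal Y Z eYZ; apply/subr0_eq/sw_pairC_inj0 => h.
apply: (sw_pair_eq0_of_action Arho gal) => b.
have := linB (bilin_tangent_action.1 b) Y Z; rewrite eYZ subrr => <-.
rewrite tangent_actionE; apply: eq_sw => a v.
by rewrite swMl; apply: eq_sw => *; rewrite scalerAr.
Qed.

Lemma tangent_fovc : hopf_galois rho -> fovc tangent_bimodule L.
Proof.
move=> gal; have [l1 l2] := bilin_tangent_action.
split=> [b|Y||a Y b|Y a b].
- exact: l1.
- exact: l2.
- exact: tangent_action_inj.
- move: Y; apply: eq_linear_tensor.
  + exact: lin_comp (l1 b) (ltr a).
  + by apply: linMl.
  move=> c v; rewrite /= tangent_lact_ten !tangent_action_ten swMl.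
  by apply: eq_sw => *; rewrite -scalerAr mulrA.
- exact: tangent_leibniz.
Qed.

Variable delta : G -> tensor G H.
Hypothesis ldelta : linear delta.
Hypothesis deltaE : forall v h,
  \sw_(v0, v1 <- delta v) ((pair v0 h : k) *: v1) = ad (sub_incl v) h.

Let deltaP := delta_coaction ldelta deltaE.
Local Notation rhoX := (diag_coaction rho delta).
Let lrhoX := lin_diag_coaction rhoP deltaP.
Let rhoX_ten := diag_coaction_ten rhoP deltaP.

(** [a_0 b_0 v_0(b_1) ⊗ a_1 v_1 b_2 = a_0 b_0 ⊗ a_1 b_1 v(b_2)] is
    [sw_delta_mul]. *)
Lemma tangent_colinear : colinear (diag_coaction rhoX rho) rho (fun t => tlift L t).
Proof.
have bL := bilin_tangent_action; have [l1 l2] := bL.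
have lL := sw_linear bL; have rhoXP := diag_right_coaction rhoP deltaP.
move=> t; rewrite -/(sw t L); move: t; apply: eq_linear_tensor.
- exact: lin_comp.
- by apply: lin_comp; [apply: lin_tmap|apply: lin_diag_coaction].
move=> Y b; rewrite sw_ten //; move: Y; apply: eq_linear_tensor.
- exact: lin_comp (l1 b).
- apply: lin_comp; first exact: lin_tmap.
  by apply: lin_comp; [apply: lin_diag_coaction|lin].
move=> a v; rewrite (diag_coaction_ten rhoXP rhoP) rhoX_ten tangent_action_ten.
transitivity (\sw_(a0, a1 <- rho a) \sw_(b0, z <- rho b) \sw_(h1, h2 <- comul z)
    ((pair v h2 : k) *: ((a0 * b0) \ox (a1 * h1)))).
  rewrite (lin_sw _ _ lrho).
  under [LHS]eq_sw => b0 b1.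
    rewrite (linZ lrho) -[rho (a * b0)]sw_id (sw_rhoM Arho); last by lin.
    rewrite swZ; under eq_sw => a0 a1 do rewrite swZ.
    over.
  rewrite exchange_sw; apply: eq_sw => a0 a1.
  by rewrite (sw_coactA rhoP (F := fun b0 h1 h2 =>
    (pair v h2 : k) *: ((a0 * b0) \ox (a1 * h1)))) //; lin.
transitivity (\sw_(a0, a1 <- rho a) \sw_(v0, v1 <- delta v) \sw_(b0, b1 <- rho b)
    (L (a0 \ox v0) b0 \ox (a1 * v1 * b1))); last first.
  have lL1 : linear (fun t : tensor X A => tlift L t) by exact: lL.
  rewrite sw_sw; last first.
    by split=> ?; [apply: lin_sw_fun => *; lin|apply: lin_sw_fun => *; lin].
  have bT : bilin (fun (t : tensor X A) (h : H) => (tlift L t : A) \ox h).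
    by split=> ?; [apply: lin_tenl|apply: lin_tenr].
  rewrite [RHS](lin_sw _ _ (lin_tmap lL1 (@lin_id _ _))).
  apply: eq_sw => a0 a1.
  rewrite sw_sw; last by lin.
  rewrite [RHS](lin_sw _ _ (lin_tmap lL1 (@lin_id _ _))).
  apply: eq_sw => v0 v1; rewrite sw_ten; last by lin.
  rewrite [RHS](lin_sw _ _ (lin_tmap lL1 (@lin_id _ _))).
  apply: eq_sw => b0 b1; rewrite tmap_ten //.
  by congr (_ \ox _); rewrite -/(sw _ _) sw_ten.
apply: eq_sw => a0 a1.
under [RHS]eq_sw => v0 v1.
  under eq_sw => b0 b1 do rewrite tangent_action_ten sw_tenl.
  rewrite (sw_coactA rhoP (F := fun b0 h1 h2 =>
    ((pair v0 h1 : k) *: (a0 * b0)) \ox (a1 * v1 * h2))); last by lin.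
  over.
rewrite [RHS]exchange_sw; apply: eq_sw => b0 z.
transitivity ((a0 * b0) \ox (a1 * \sw_(h1, h2 <- comul z) ((pair v h2 : k) *: h1))).
  by rewrite swMl sw_tenr; apply: eq_sw => h1 h2; rewrite -scalerAr tenZr.
rewrite -(sw_delta_mul deltaE) [RHS]exchange_sw swMl sw_tenr; apply: eq_sw => h1 h2.
rewrite swMl sw_tenr; apply: eq_sw => v0 v1.
by rewrite -scalerAr tenZr tenZl mulrA.
Qed.

(** On [c ⊗ v] the identity is [delta_act] with the remaining factors carried by
    the linear map [phi]. *)
Lemma tangent_covariant a Y b :
  rhoX (tangent_lact a (tangent_ract Y b)) =
  tensor_lact tangent_bimodule (rho a)
    (tensor_ract tangent_bimodule (rhoX Y) (rho b)).
Proof.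
change (rhoX (tangent_lact a (tangent_ract Y b)) =
  \sw_(a0, a1 <- rho a) \sw_(y, l <- \sw_(x, l <- rhoX Y) \sw_(b0, b1 <- rho b)
    (tangent_ract x b0 \ox (l * b1))) (tangent_lact a0 y \ox (a1 * l))).
move: Y; apply: eq_linear_tensor; [by lin|by lin|] => c v.
pose phi (a0 : A) (a1 : H) (c0 : A) (c1 : H) (b0 : A) (t : tensor G H) : tensor X H :=
  \sw_(w, l <- t) (((a0 * (c0 * b0)) \ox w) \ox (a1 * (c1 * l))).
transitivity (\sw_(a0, a1 <- rho a) \sw_(c0, c1 <- rho c) \sw_(b0, z <- rho b)
  phi a0 a1 c0 c1 b0 (\sw_(h1, h2 <- comul z) \sw_(w0, w1 <- delta (act v h2))
    (w0 \ox (h1 * w1)))).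
  rewrite tangent_ract_ten (lin_sw _ _ (ltr a)) (lin_sw _ _ lrhoX).
  under eq_sw => b0 b1.
    rewrite tangent_lact_ten rhoX_ten (sw_rhoM Arho); last by lin.
    under eq_sw => a0 a1 do [rewrite (sw_rhoM Arho); last by lin].
    over.
  rewrite [LHS]exchange_sw; apply: eq_sw => a0 a1.
  rewrite [LHS]exchange_sw; apply: eq_sw => c0 c1.
  rewrite (sw_coactA rhoP (F := fun b0 h1 h2 => \sw_(w0, w1 <- delta (act v h2))
    (((a0 * (c0 * b0)) \ox w0) \ox (a1 * (c1 * h1) * w1)))); last by lin.
  apply: eq_sw => b0 z; rewrite /phi sw_sw; last by lin.
  apply: eq_sw => h1 h2; rewrite sw_sw; last by lin.
  apply: eq_sw => w0 w1; rewrite sw_ten; last by lin.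
  by rewrite !mulrA.
apply: eq_sw => a0 a1.
rewrite rhoX_ten sw_sw; last by lin.
rewrite sw_sw; last by lin.
apply: eq_sw => c0 c1.
rewrite sw_sw; last by lin.
under [RHS]eq_sw => v0 v1.
  rewrite sw_ten; last by lin.
  rewrite sw_sw; last by lin.
  under eq_sw => b0 b1.
    rewrite sw_ten; last by lin.
    rewrite tangent_ract_ten (lin_sw _ _ (ltr a0)) sw_tenl.
    under eq_sw => b00 b01 do rewrite tangent_lact_ten.
    over.
  rewrite (sw_coactA rhoP (F := fun b0 h1 h2 =>
    ((a0 * (c0 * b0)) \ox act v0 h1) \ox (a1 * (c1 * v1 * h2)))); last by lin.
  over.
rewrite [RHS]exchange_sw; apply: eq_sw => b0 z.
rewrite (delta_act deltaE bact pair_act) /phi sw_sw; last by lin.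
apply: eq_sw => v0 v1; rewrite sw_sw; last by lin.
apply: eq_sw => h1 h2; rewrite sw_ten; last by lin.
by rewrite !mulrA.
Qed.

Lemma tangent_covariant_fovc :
  hopf_galois rho -> covariant_fovc tangent_bimodule L rho rhoX.
Proof.
move=> gal; split.
- exact: tangent_fovc.
- exact: diag_right_coaction.
- exact: tangent_covariant.
- exact: tangent_colinear.
Qed.

End VectorFields.

(** * Coordinates in a basis *)

Lemma basis_coord (k : fieldType) (V : lmodType k) n (e : 'I_n -> V) :
  is_basis e -> exists c : 'I_n -> V -> k^o,
    [/\ forall i, linear (c i), forall v, v = \sum_i (c i v : k) *: e i
      & forall i j, c i (e j) = (i == j)%:R].
Proof.
move=> [span free]; have [c cE] := choice span.
have uniq (b b' : 'I_n -> k) : \sum_i b i *: e i = \sum_i b' i *: e i -> b =1 b'.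
  move=> /eqP; rewrite -subr_eq0 -sumrB => /eqP bb' i; apply/eqP; rewrite -subr_eq0.
  apply/eqP/(free (fun i => b i - b' i)); rewrite -[RHS]bb'.
  by apply: eq_bigr => j _; rewrite scalerBl.
exists (fun i v => c v i); split=> // [i a v w|i j].
  apply: (uniq (c (a *: v + w)) (fun i => a * c v i + c w i)).
  rewrite -cE {1}(cE v) {1}(cE w) scaler_sumr -big_split.
  by apply: eq_bigr => j _; rewrite scalerDl scalerA.
apply: (uniq _ (fun i => (i == j)%:R)); rewrite -cE (bigD1 j) //= eqxx scale1r.
by rewrite big1 ?addr0 // => l /negbTE ->; rewrite scale0r.
Qed.

Section Basis.
Variables (k : fieldType) (V W : lmodType k) (n : nat) (e : 'I_n -> V).
Hypothesis eP : is_basis e.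

Lemma eq_on_basis (F F' : V -> W) :
  linear F -> linear F' -> (forall i, F (e i) = F' (e i)) -> F =1 F'.
Proof.
move=> lF lF' FF' v; have [c [_ cE _]] := basis_coord eP.
rewrite (cE v) (lin_bigsum _ _ _ lF) (lin_bigsum _ _ _ lF').
by apply: eq_bigr => i _; rewrite (linZ lF) (linZ lF') FF'.
Qed.

Lemma tensor_basisP (t : tensor V W) :
  exists w : 'I_n -> W, t = \sum_i e i \ox w i.
Proof.
have [c [cl cE _]] := basis_coord eP.
exists (fun i => \sw_(v, w <- t) ((c i v : k) *: w)).
rewrite -[LHS]sw_id; under [RHS]eq_bigr do rewrite sw_tenr.
rewrite -sw_sum; apply: eq_sw => v w.
rewrite {1}(cE v) (lin_bigsum (F := fun v => v \ox w)); last by lin.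
by apply: eq_bigr => i _; rewrite tenZl tenZr.
Qed.

Lemma tensor_basis_inj (w w' : 'I_n -> W) :
  \sum_i e i \ox w i = \sum_i e i \ox w' i -> w =1 w'.
Proof.
have [c [cl _ ce]] := basis_coord eP.
have bc i : bilin (fun (v : V) (x : W) => (c i v : k) *: x) by lin.
suff E (x : 'I_n -> W) i : sw (\sum_j e j \ox x j) (fun v y => (c i v : k) *: y) = x i.
  by move=> ww' i; rewrite -(E w) ww' E.
rewrite (lin_bigsum _ _ _ (sw_linear (bc i))) (bigD1 i) //= sw_ten // ce eqxx scale1r.
rewrite big1 ?addr0 // => j /negbTE ji.
by rewrite sw_ten // ce eq_sym ji scale0r.
Qed.

End Basis.

Section TangentBasis.
Variables (k : fieldType) (H : hopfAlgType k) (g : submodClosed (fdual H)).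
Local Notation G := (subspace g).
Variables (n : nat) (chi : 'I_n -> G).
Hypothesis chiP : is_basis chi.

(** [χ_i(xy) - χ_i(x) ε(y) = Σ_j f_i^j(x) χ_j(y)] is the hypothesis on [Δ(χ_i)]
    paired with [x] and [y]. *)
Lemma tangent_act (f : 'I_n -> 'I_n -> fdual H) :
  (forall i, fd_comul (sub_incl (chi i)) =
    sub_incl (chi i) \ox fd_unit H + \sum_(j < n) f i j \ox sub_incl (chi j)) ->
  exists act : G -> H -> G,
    [/\ bilin act,
        forall v x y, pair (act v x) y = pair v (x * y) - (counit y : k) *: pair v x
      & forall i x, act (chi i) x = \sum_j ev (f i j) x *: chi j].
Proof.
move=> fP; have [c [cl cE ce]] := basis_coord chiP.
pose act v x := \sum_i (c i v : k) *: \sum_j ev (f i j) x *: chi j.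
have bact : bilin act.
  by split=> *; apply: lin_sum => i; [lin|apply: lin_scaler; apply: lin_sum => j; lin].
have act_chi i x : act (chi i) x = \sum_j ev (f i j) x *: chi j.
  rewrite /act (bigD1 i) //= ce eqxx scale1r [X in _ + X]big1 ?addr0 // => j /negbTE ji.
  by rewrite ce ji scale0r.
exists act; split=> // v x y; have [la1 la2] := bact; have [pl pr] := pair_bilin g.
move: v; apply: (eq_on_basis chiP).
- by lin.
- by apply: lin_sub; lin.
move=> i; rewrite act_chi (lin_bigsum _ _ _ (pl y)).
have := fd_comulE (sub_incl (chi i)) x y.
rewrite fP fd_pairD fd_pair_ten fd_pair_sum -/(pair (chi i) (x * y)) => <-.
rewrite [X in X - _]addrC (_ : _ * _ = (counit y : k) *: pair (chi i) x); last exact: mulrC.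
rewrite addrK; apply: eq_bigr => j _.
by rewrite (linZ (pl y)) fd_pair_ten.
Qed.

Lemma tangent_delta (N : 'I_n -> 'I_n -> H) :
  (forall i, ad (sub_incl (chi i)) =1 tensor_end (\sum_(j < n) chi j \ox N i j)) ->
  exists delta : G -> tensor G H,
    [/\ linear delta, forall i, delta (chi i) = \sum_j chi j \ox N i j
      & forall v h, \sw_(v0, v1 <- delta v) ((pair v0 h : k) *: v1) = ad (sub_incl v) h].
Proof.
move=> NP; have [c [cl cE ce]] := basis_coord chiP.
pose delta v := \sum_i (c i v : k) *: \sum_j (chi j \ox N i j).
have ldelta : linear delta by apply: lin_sum => i; lin.
have delta_chi i : delta (chi i) = \sum_j chi j \ox N i j.
  rewrite /delta (bigD1 i) //= ce eqxx scale1r [X in _ + X]big1 ?addr0 // => j /negbTE ji.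
  by rewrite ce ji scale0r.
exists delta; split=> // v h; move: v; apply: (eq_on_basis chiP).
- by lin.
- have lad : linear (fun v : G => \sw_(x, h3 <- comul h) \sw_(h1, h2 <- comul x)
      ((pair v h2 : k) *: (h1 * antipode h3))) by lin.
  by move=> a u v; rewrite !adE; apply: lad.
by move=> i; rewrite delta_chi NP.
Qed.

End TangentBasis.

(** * The theorem *)

Theorem proposition3p16 (k : fieldType) (H : hopfAlgType k) (A : algType k)
    (rho : A -> tensor A H) (Arho : comodule_algebra rho)
    (g : submodClosed (fdual H)) (gT : quantum_tangent_space g)
    (n : nat) (chi : 'I_n -> subspace g) (chi_basis : is_basis chi)
    (f : 'I_n -> 'I_n -> fdual H)
    (fP : forall i, fd_comul (sub_incl (chi i)) =
      sub_incl (chi i) \ox fd_unit H + \sum_(j < n) f i j \ox sub_incl (chi j)) :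
  exists bm : bimodule A (tensor A (subspace g)),
    [/\ forall (a a' a'' : A) (i : 'I_n),
          lact bm a (ract bm (a' \ox chi i) a'') =
          \sum_(j < n) tlift (fun (a0 : A) (a1 : H) =>
             (ev (f i j) a1 *: (a * a' * a0)) \ox chi j) (rho a''),
        forall (X : tensor A (subspace g)) (a a' : A),
          tangent_action rho X (a * a') =
          tangent_action rho X a * a' + tangent_action rho (ract bm X a) a',
        hopf_galois rho -> fovc bm (@tangent_action k H A rho g)
      & hopf_galois rho -> bicovariant g ->
        (exists! N : 'I_n -> 'I_n -> H, forall i,
           ad (sub_incl (chi i)) =1 tensor_end (\sum_(j < n) chi j \ox N i j)) /\
        (forall N : 'I_n -> 'I_n -> H,
           (forall i,
              ad (sub_incl (chi i)) =1 tensor_end (\sum_(j < n) chi j \ox N i j)) ->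
           exists rhoX : tensor A (subspace g) ->
                         tensor (tensor A (subspace g)) H,
             (forall (a : A) (i : 'I_n), rhoX (a \ox chi i) =
                \sum_(j < n) tlift (fun (a0 : A) (a1 : H) =>
                   (a0 \ox chi j) \ox (a1 * N i j)) (rho a)) /\
             covariant_fovc bm (@tangent_action k H A rho g) rho rhoX)].
Proof.
have [act [bact pair_act act_chi]] := tangent_act chi_basis fP.
have rhoP := comodule_algebra_coaction Arho.
exists (tangent_bimodule Arho (qts_plus gT) bact pair_act); split.
- move=> a a' a'' i.
  rewrite /= (tangent_ract_ten _ bact) (lin_sw _ _ ((bilin_tangent_lact _ _).2 a)).
  transitivity (\sw_(a0, a1 <- rho a'')
    \sum_(j < n) (ev (f i j) a1 *: (a * a' * a0)) \ox chi j); last exact: sw_sum.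
  apply: eq_sw => a0 a1; rewrite tangent_lact_ten act_chi.
  rewrite (lin_bigsum _ _ _ (@lin_tenr _ _ _ _ _ _ (@lin_id _ _))).
  by apply: eq_bigr => j _; rewrite tenZr tenZl mulrA.
- by move=> *; apply: (tangent_leibniz Arho).
- exact: tangent_fovc.
move=> gal [_ adP]; split.
  have [t tP] := choice adP.
  have [N NE] := choice (fun i => tensor_basisP chi_basis (t (chi i))).
  exists N; split=> [i|N' N'P]; first by rewrite -NE.
  apply/funext => i; apply/funext; apply: (tensor_basis_inj chi_basis).
  rewrite -NE; apply: sw_pair_inj => h.
  by rewrite -[LHS]/(tensor_end _ h) -[RHS]/(tensor_end _ h) -tP N'P.
move=> N NP; have [delta [ldelta delta_chi deltaE]] := tangent_delta chi_basis NP.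
have deltaP := delta_coaction ldelta deltaE.
exists (diag_coaction rho delta); split; last exact: tangent_covariant_fovc.
move=> a i; rewrite (diag_coaction_ten rhoP deltaP) delta_chi.
transitivity (\sw_(a0, a1 <- rho a)
  \sum_(j < n) (a0 \ox chi j) \ox (a1 * N i j)); last exact: sw_sum.
apply: eq_sw => a0 a1.
have b : bilin (fun (v : subspace g) (h : H) => (a0 \ox v) \ox (a1 * h)) by lin.
rewrite (lin_bigsum _ _ _ (sw_linear b)).
by apply: eq_bigr => j _; rewrite sw_ten.
Qed.
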